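(* Let $\overline{f}^{\,n+1}_{k,l}$ be the cell values produced by one time step (from $t_n$ to $t_{n+1}=t_n+\Delta t$) of the two-dimensional conservative cascade semi-Lagrangian (CCSL) scheme, described in the context, on a uniform grid with $\Delta x=\Delta y=h$, applied to the transport equation $\partial_t f+\nabla_{\mathbf x}\cdot(\mathbf a f)=0$ with $\nabla_{\mathbf x}\cdot\mathbf a=0$. Suppose that the cell averages at time $t_n$ are exact, i.e. $\overline{f}^{\,n}_{k,l}=\frac1{h^2}\iint_{\Omega_{k,l}}f(x,y,t_n)\,dx\,dy$ for all $k,l$, and that $f$, $p$ and $q$ are twice continuously differentiable functions. Then, as $h\to0$, $$\left|\frac1{h^2}\iint_{\Omega_{k,l}}f(x,y,t_{n+1})\,dx\,dy-\overline{f}^{\,n+1}_{k,l}\right|=\mathcal O(h^2)$$ for all cell indices $k=0,\dots,N_x$ and $l=0,\dots,N_y$.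
   Context: **Equation, grid and characteristics.** The domain is $\Omega=[x_{\min},x_{\max}]\times[y_{\min},y_{\max}]$, with grid points $x_i=x_{\min}+ih$, $y_j=y_{\min}+jh$, $i,j\in\frac12\mathbb Z$, where $h=\Delta x=(x_{\max}-x_{\min})/N_x=\Delta y=(y_{\max}-y_{\min})/N_y$. Cells are $\Omega_{k,l}=[x_{k-1/2},x_{k+1/2}]\times[y_{l-1/2},y_{l+1/2}]$. The function $f$ solves $\partial_t f+\nabla_{\mathbf x}\cdot(\mathbf a f)=0$ with $\nabla_{\mathbf x}\cdot\mathbf a=0$; $f$ and $\mathbf a$ are regarded as defined (through the boundary conditions, e.g. periodic extension) wherever the scheme below uses them. For a point $\mathbf x_0$, let $\mathbf X(t;t_{n+1},\mathbf x_0)=(X_1,X_2)$ solve $\frac{d\mathbf X}{dt}=\mathbf a(\mathbf X,t)$, $\mathbf X(t_{n+1})=\mathbf x_0$. **Functions $p$ and $q$.** For fixed $\xi$, let $\mathcal X_\xi(x_0)=X_1(t_n;t_{n+1},(x_0,\xi))$ and $p(x,\xi)=X_2(t_n;t_{n+1},(\mathcal X_\xi^{-1}(x),\xi))$. For fixed $\eta$, let $\mathcal Y_\eta(y_0)=X_2(t_n;t_{n+1},(\eta,y_0))$ and $q(y,\eta)=X_1(t_n;t_{n+1},(\eta,\mathcal Y_\eta^{-1}(y)))$. Thus the horizontal line $y=y_j$ at time $t_{n+1}$ is traced back to the curve $y=p(x,y_j)$ at time $t_n$, and the vertical line $x=x_i$ to the curve $x=q(y,x_i)$. The maps $\mathcal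 X_\xi,\mathcal Y_\eta$ are assumed invertible (smooth characteristics). **1D conservative reconstruction operator $\mathcal T$** (degree $2d+1$). Given a uniform 1D grid with cell averages $\{\overline g_i\}$ on the cells $[x_{i-1/2},x_{i+1/2}]$ of width $h$, and increasing face positions $\{x^*_{i-1/2}\}$, for each cell $j$ let $F_j$ be the primitive $F_j(x)=\int_{x_{j-1/2}}^x g(\zeta)\,d\zeta$, whose values at half-grid points are known from the cell masses $h\overline g_i$, and let $F_j^{2d+1}$ be the polynomial of degree at most $2d+1$ interpolating $F_j$ at the $2d+2$ points $x_{j-1/2+k}$, $k=-d,\dots,d+1$. If $x^*_{i-1/2}\in[x_{\mu-1/2},x_{\mu+1/2})$ and $x^*_{i+1/2}\in[x_{\lambda-1/2},x_{\lambda+1/2})$ with $\lambda\ge\mu$, the output is $$m_i^*=F_\lambda^{2d+1}(x^*_{i+1/2})+\sum_{c=\mu}^{\lambda-1}h\overline g_c-F_\mu^{2d+1}(x^*_{i-1/2}),$$ and $\mathcal T(\{x^*_{i-1/2}\},\{\overline g_i\})=\{m_i^*\}$. **One CCSL step.** (1) Trace the corners $(x_{i-1/2},y_{j-1/2})$ at time $t_{n+1}$ back along characteristics to $(x^*_{i-1/2,j-1/2},y^*_{i-1/2,j-1/2})$ at time $t_n$. (2) Intermediate grid points: $\widetilde y_{i-1/2,j-1/2}=p(x_{i-1/2},y_{j-1/2})$, the ordinate of the intersection of the backtracked curve of $y=y_{j-1/2}$ with the line $x=x_{i-1/2}$. Set $\overline y_{i,j\pm1/2}=\frac12(\widetilde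 y_{i-1/2,j\pm1/2}+\widetilde y_{i+1/2,j\pm1/2})$. The intermediate cell is $I_{ij}=[x_{i-1/2},x_{i+1/2}]\times[\overline y_{i,j-1/2},\overline y_{i,j+1/2}]$. (3) For each column $i$, compute $\{m_{I_{ij}}\}_j=\mathcal T(\{\overline y_{i,j-1/2}\}_j,\{\Delta x\,\overline f^{\,n}_{i,j}\}_j)$ in the $y$-direction. (4) For each row $j$, set $\overline x_{i-1/2,j}=\frac12(x^*_{i-1/2,j-1/2}+x^*_{i-1/2,j+1/2})$ and compute $\{m_{B_{ij}}\}_i=\mathcal T(\{\overline x_{i-1/2,j}\}_i,\{m_{I_{ij}}/\Delta x\}_i)$ in the $x$-direction. (5) Set $\overline f^{\,n+1}_{ij}=m_{B_{ij}}/(\Delta x\Delta y)$. **Standing assumptions.** Characteristics are traced exactly, and the interpolation used in $\mathcal T$ is of sufficiently high order that the errors it induces in the cell masses are $\mathcal O(h^4)$, so that the geometric error dominates. The scheme is applicable: $\frac{\Delta a^x}{\Delta x}\Delta t<1$ and $\frac{\Delta a^y}{\Delta y}\Delta t<1$, where $\Delta a^x=\max|a^x_{i+1,j}-a^x_{i,j}|$, $\Delta a^y=\max|a^y_{i,j+1}-a^y_{i,j}|$ and $a^x_{ij},a^y_{ij}$ are the velocity components at $(x_i,y_j)$; and the left-right and bottom-top ordering of grid points is preserved after backtracking. The asymptotics are for $h\to0$ with $f$, $\mathbf a$, $t_n$, $\Delta t$ fixed.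
   Formalization: The context's ''smooth characteristics'' is made precise: the backtracking map X is assumed three times continuously differentiable in space, in addition to f, p, q being C^2; with merely C^2 characteristics the O(h^2) bound can fail (e.g. order h^{3/2}). *)

(* Defs.v *)
From Stdlib Require Import Reals ZArith List Lra Lia.
From Coquelicot Require Export Coquelicot.

Open Scope R_scope.

(* A field g is used as g x y t.  [Ck k g]: all partial derivatives of g in the
   space variables x, y of order at most k exist and are continuous in (x,y,t).
   No t-derivative is required, so this is weaker than being C^k in (x,y,t).
   Data known only for t in [t0,t1] are frozen in time outside that interval,
   which preserves [Ck k]; all differential equations below are imposed on the
   open interval only. *)
Fixpoint Ck (k : nat) (g : R -> R -> R -> R) : Prop :=
  (forall x y t : R,
     continuous (fun z : R * R * R => g (fst (fst z)) (snd (fst z)) (snd z))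
                (x, y, t)) /\
  match k with
  | O => True
  | S k' => exists gx gy : R -> R -> R -> R,
      (forall x y t : R, is_derive (fun u => g u y t) x (gx x y t)) /\
      (forall x y t : R, is_derive (fun v => g x v t) y (gy x y t)) /\
      Ck k' gx /\ Ck k' gy
  end.

Definition Ck2 (k : nat) (g : R -> R -> R) : Prop := Ck k (fun x y _ => g x y).

Definition divergence_free (a1 a2 : R -> R -> R -> R) (t0 t1 : R) : Prop :=
  forall x y t, t0 < t < t1 ->
    Derive (fun u => a1 u y t) x + Derive (fun v => a2 x v t) y = 0.

Definition solves_transport (a1 a2 f : R -> R -> R -> R) (t0 t1 : R) : Prop :=
  forall x y t, t0 < t < t1 ->
    is_derive (fun s => f x y s) t
      (- (Derive (fun u => a1 u y t * f u y t) x
          + Derive (fun v => a2 x v t * f x v t) y)).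

(* X1 x0 y0 t, X2 x0 y0 t are the coordinates of X(t; t1, (x0,y0)). *)
Definition is_characteristics (a1 a2 X1 X2 : R -> R -> R -> R) (t0 t1 : R)
  : Prop :=
  forall x0 y0,
    X1 x0 y0 t1 = x0 /\ X2 x0 y0 t1 = y0 /\
    forall t, t0 < t < t1 ->
      is_derive (fun s => X1 x0 y0 s) t (a1 (X1 x0 y0 t) (X2 x0 y0 t) t) /\
      is_derive (fun s => X2 x0 y0 s) t (a2 (X1 x0 y0 t) (X2 x0 y0 t) t).

Definition mutual_inverse (F G : R -> R) : Prop :=
  (forall u, G (F u) = u) /\ (forall v, F (G v) = v).

(* [invX xi] stands for the inverse of x0 |-> X_1(tn; tn+1, (x0,xi)) and
   [invY eta] for that of y0 |-> X_2(tn; tn+1, (eta,y0)). *)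
Definition curve_p (X2 : R -> R -> R -> R) (invX : R -> R -> R) (tn : R)
  (x xi : R) : R := X2 (invX xi x) xi tn.

Definition curve_q (X1 : R -> R -> R -> R) (invY : R -> R -> R) (tn : R)
  (y eta : R) : R := X1 eta (invY eta y) tn.

(* With origin o, [face o h i] is the half-grid point of index i - 1/2. *)
Definition face (o h : R) (i : Z) : R := o + (IZR i - / 2) * h.

(* The mu such that x lies in [face o h mu, face o h (mu+1)); Int_part is the
   floor function. *)
Definition cell_index (o h x : R) : Z := Int_part ((x - o) / h + / 2).

(* Sum of g c over a <= c < b; it is 0 when b <= a. *)
Definition Zsum (g : Z -> R) (a b : Z) : R :=
  fold_right Rplus 0
    (map (fun n => g (a + Z.of_nat n)%Z) (seq 0 (Z.to_nat (b - a)))).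

Definition lagrange_basis (n : nat) (node : nat -> R) (k : nat) (x : R) : R :=
  fold_right Rmult 1
    (map (fun m => if Nat.eqb m k then 1 else (x - node m) / (node k - node m))
         (seq 0 (S n))).

Definition lagrange (n : nat) (node val : nat -> R) (x : R) : R :=
  sum_f_R0 (fun k => val k * lagrange_basis n node k x) n.

(* F_j at face j+k: the integral from face j to face j+k, of either sign. *)
Definition primitive_at (h : R) (g : Z -> R) (j k : Z) : R :=
  Zsum (fun c => h * g c) j (j + k) - Zsum (fun c => h * g c) (j + k) j.

(* F_j^{2d+1}; the node numbered k = 0,...,2d+1 is face j+k-d. *)
Definition primitive_interp (d : nat) (o h : R) (g : Z -> R) (j : Z) (x : R)
  : R :=
  lagrange (2 * d + 1)
    (fun k => face o h (j + (Z.of_nat k - Z.of_nat d)))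
    (fun k => primitive_at h g j (Z.of_nat k - Z.of_nat d)) x.

(* The operator T; xs i is the displaced position of face i. *)
Definition remap (d : nat) (o h : R) (xs : Z -> R) (g : Z -> R) (i : Z) : R :=
  let mu := cell_index o h (xs i) in
  let lam := cell_index o h (xs (i + 1)%Z) in
  primitive_interp d o h g lam (xs (i + 1)%Z)
  + Zsum (fun c => h * g c) mu lam
  - primitive_interp d o h g mu (xs i).

Definition cell_average (xmin ymin h : R) (g : R -> R -> R) (k l : Z) : R :=
  / (h ^ 2) *
  RInt (fun y => RInt (fun x => g x y) (face xmin h k) (face xmin h (k + 1)))
       (face ymin h l) (face ymin h (l + 1)).

(* The ordinate indexed (i, j-1/2). *)
Definition ybar (xmin ymin h : R) (p : R -> R -> R) (i j : Z) : R :=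
  / 2 * (p (face xmin h i) (face ymin h j)
         + p (face xmin h (i + 1)) (face ymin h j)).

(* The abscissa indexed (i-1/2, j); Phi1 is the first coordinate of the
   foot at tn of the characteristic through a given point at tn+1. *)
Definition xbar (xmin ymin h : R) (Phi1 : R -> R -> R) (i j : Z) : R :=
  / 2 * (Phi1 (face xmin h i) (face ymin h j)
         + Phi1 (face xmin h i) (face ymin h (j + 1))).

Definition mass_I (d : nat) (xmin ymin h : R) (p : R -> R -> R)
  (fbar : Z -> Z -> R) (i j : Z) : R :=
  remap d ymin h (fun j' => ybar xmin ymin h p i j')
    (fun j' => h * fbar i j') j.

Definition mass_B (d : nat) (xmin ymin h : R) (Phi1 p : R -> R -> R)
  (fbar : Z -> Z -> R) (i j : Z) : R :=
  remap d xmin h (fun i' => xbar xmin ymin h Phi1 i' j)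
    (fun i' => mass_I d xmin ymin h p fbar i' j / h) i.

Definition ccsl_step (d : nat) (xmin ymin h : R) (Phi1 p : R -> R -> R)
  (fbar : Z -> Z -> R) (i j : Z) : R :=
  mass_B d xmin ymin h Phi1 p fbar i j / (h * h).

(* Over finitely many grid points, max|..| / h * dt < 1 is the same as the
   bound for every pair of neighbours.  ta is the time at which the velocity
   is sampled. *)
Definition applicable (xmin ymin h dt ta : R) (Nx Ny : nat)
  (a1 a2 : R -> R -> R -> R) : Prop :=
  let gx i := xmin + INR i * h in
  let gy j := ymin + INR j * h in
  (forall i j, (i < Nx)%nat -> (j <= Ny)%nat ->
     Rabs (a1 (gx (S i)) (gy j) ta - a1 (gx i) (gy j) ta) / h * dt < 1) /\
  (forall i j, (i <= Nx)%nat -> (j < Ny)%nat ->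
     Rabs (a2 (gx i) (gy (S j)) ta - a2 (gx i) (gy j) ta) / h * dt < 1).

(* Ordering of the traced-back corners of the cells 0..Nx x 0..Ny. *)
Definition order_preserved (xmin ymin h : R) (Nx Ny : nat)
  (Phi1 Phi2 : R -> R -> R) : Prop :=
  (forall i j, (0 <= i <= Z.of_nat Nx)%Z -> (0 <= j <= Z.of_nat Ny + 1)%Z ->
     Phi1 (face xmin h i) (face ymin h j)
     < Phi1 (face xmin h (i + 1)) (face ymin h j)) /\
  (forall i j, (0 <= i <= Z.of_nat Nx + 1)%Z -> (0 <= j <= Z.of_nat Ny)%Z ->
     Phi2 (face xmin h i) (face ymin h j)
     < Phi2 (face xmin h i) (face ymin h (j + 1))).

Lemma lagrange_basis_self n node k :
  (forall i j, (i <= n)%nat -> (j <= n)%nat -> i <> j -> node i <> node j) ->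
  (k <= n)%nat -> lagrange_basis n node k (node k) = 1.
Proof.
intros Hn Hk. unfold lagrange_basis.
assert (H : forall m, In m (seq 0 (S n)) -> (m <= n)%nat).
{ intros m Hm. apply in_seq in Hm. lia. }
revert H. induction (seq 0 (S n)) as [|a s IH]; intros H; simpl; [reflexivity|].
rewrite IH by (intros m Hm; apply H; right; exact Hm).
destruct (Nat.eqb_spec a k) as [e|e]; [ring|].
field. apply Rminus_eq_contra. apply Hn; auto. apply H. left; reflexivity.
Qed.

Lemma lagrange_basis_other n node k m :
  (m <= n)%nat -> m <> k -> lagrange_basis n node k (node m) = 0.
Proof.
intros Hm Hmk. unfold lagrange_basis.
assert (H : In m (seq 0 (S n))) by (apply in_seq; lia).
revert H. induction (seq 0 (S n)) as [|a s IH]; intros H; [destruct H|].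
simpl. destruct H as [->|H].
- destruct (Nat.eqb_spec m k) as [e|e]; [contradiction|]. unfold Rdiv. ring.
- rewrite IH by exact H. ring.
Qed.

Lemma lagrange_node n node val k :
  (forall i j, (i <= n)%nat -> (j <= n)%nat -> i <> j -> node i <> node j) ->
  (k <= n)%nat -> lagrange n node val (node k) = val k.
Proof.
intros Hn Hk. unfold lagrange.
assert (H : forall N, (N <= n)%nat ->
  sum_f_R0 (fun i => val i * lagrange_basis n node i (node k)) N
  = if Nat.leb k N then val k else 0).
{ induction N as [|N IH]; intros HN; simpl.
  - destruct (Nat.leb_spec k 0).
    + replace k with 0%nat by lia. rewrite lagrange_basis_self by (auto; lia). ring.
    + rewrite lagrange_basis_other by lia. ring.
  - rewrite IH by lia.
    destruct (Nat.eq_dec k (S N)) as [e|e].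
    + rewrite e at 2. rewrite <- e, lagrange_basis_self by auto.
      destruct (Nat.leb_spec k N); [lia|].
      destruct (Nat.leb_spec k k); [ring|lia].
    + rewrite lagrange_basis_other by lia.
      destruct (Nat.leb_spec k N); destruct (Nat.leb_spec k (S N));
        try lia; ring. }
rewrite H by lia. destruct (Nat.leb_spec k n); [reflexivity|lia].
Qed.

Lemma mul_affine_poly n (c : nat -> R) al be :
  exists c' : nat -> R, forall x,
    (al * x + be) * sum_f_R0 (fun i => c i * x ^ i) n
    = sum_f_R0 (fun i => c' i * x ^ i) (S n).
Proof.
exists (fun i => (if Nat.leb i n then be * c i else 0)
              + match i with O => 0 | S i' => al * c i' end).
intros x.
rewrite (sum_eq _ (fun i => (if Nat.leb i n then be * c i else 0) * x ^ i
       + match i with O => 0 | S i' => al * c i' end * x ^ i) (S n))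
  by (intros; ring).
rewrite sum_plus.
rewrite (tech5 (fun i => (if Nat.leb i n then be * c i else 0) * x ^ i)).
rewrite (decomp_sum (fun i => match i with O => 0 | S i' => al * c i' end * x ^ i))
  by lia.
simpl Nat.pred.
rewrite (sum_eq (fun i => (if Nat.leb i n then be * c i else 0) * x ^ i)
           (fun i => c i * x ^ i * be) n)
  by (intros i Hi; destruct (Nat.leb_spec i n); [ring|lia]).
rewrite (sum_eq (fun i => al * c i * x ^ S i) (fun i => c i * x ^ i * (al * x)) n)
  by (intros; simpl; ring).
rewrite <- !scal_sum. destruct (Nat.leb_spec (S n) n); [lia|]. ring.
Qed.

Lemma poly_le n m (c : nat -> R) : (n <= m)%nat ->
  exists c' : nat -> R, forall x,
    sum_f_R0 (fun i => c i * x ^ i) n = sum_f_R0 (fun i => c' i * x ^ i) m.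
Proof.
intros H. exists (fun i => if Nat.leb i n then c i else 0). intros x.
induction m as [|m IH].
- replace n with 0%nat by lia. simpl. ring.
- destruct (Nat.eq_dec n (S m)) as [e|e].
  + subst n. apply sum_eq. intros i Hi.
    destruct (Nat.leb_spec i (S m)); [reflexivity|lia].
  + rewrite IH by lia. rewrite tech5.
    destruct (Nat.leb_spec (S m) n); [lia|]. ring.
Qed.

Lemma lagrange_basis_poly n node k : (k <= n)%nat ->
  exists c : nat -> R, forall x,
    lagrange_basis n node k x = sum_f_R0 (fun i => c i * x ^ i) n.
Proof.
intros Hk.
assert (H : forall s : list nat, exists c : nat -> R, forall x,
  fold_right Rmult 1 (map (fun m => if Nat.eqb m k then 1
      else (x - node m) / (node k - node m)) s)
  = sum_f_R0 (fun i => c i * x ^ i)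
      (length s - count_occ Nat.eq_dec s k)%nat).
{ induction s as [|a s [c Hc]].
  - exists (fun _ => 1). intros x. simpl. ring.
  - pose proof (count_occ_bound Nat.eq_dec k s) as Hb.
    destruct (Nat.eq_dec a k) as [e|e].
    + exists c. intros x. subst a. cbn [map fold_right length].
      rewrite count_occ_cons_eq by reflexivity.
      rewrite Nat.eqb_refl, Rmult_1_l. apply Hc.
    + destruct (mul_affine_poly (length s - count_occ Nat.eq_dec s k) c
                  (/ (node k - node a)) (- node a / (node k - node a)))
        as [c' Hc'].
      exists c'. intros x. cbn [map fold_right length].
      rewrite count_occ_cons_neq by exact e.
      replace (S (length s) - count_occ Nat.eq_dec s k)%nat
        with (S (length s - count_occ Nat.eq_dec s k)) by lia.
      destruct (Nat.eqb_spec a k) as [e'|_]; [contradiction|].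
      rewrite <- Hc', Hc. unfold Rdiv. ring. }
destruct (H (seq 0 (S n))) as [c Hc].
rewrite length_seq in Hc.
assert (Ho : (0 < count_occ Nat.eq_dec (seq 0 (S n)) k)%nat).
{ apply count_occ_In. apply in_seq. lia. }
destruct (poly_le (S n - count_occ Nat.eq_dec (seq 0 (S n)) k) n c)
  as [c' Hc']; [lia|].
exists c'. intros x. unfold lagrange_basis. rewrite Hc. apply Hc'.
Qed.

Lemma lagrange_poly n node val :
  exists c : nat -> R, forall x,
    lagrange n node val x = sum_f_R0 (fun i => c i * x ^ i) n.
Proof.
unfold lagrange.
assert (H : forall N, (N <= n)%nat -> exists c : nat -> R, forall x,
  sum_f_R0 (fun k => val k * lagrange_basis n node k x) N
  = sum_f_R0 (fun i => c i * x ^ i) n).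
{ induction N as [|N IH]; intros HN.
  - destruct (lagrange_basis_poly n node 0) as [c Hc]; [lia|].
    exists (fun i => val 0%nat * c i). intros x. cbn [sum_f_R0].
    rewrite Hc, scal_sum. apply sum_eq. intros; ring.
  - destruct IH as [c0 H0]; [lia|].
    destruct (lagrange_basis_poly n node (S N)) as [c Hc]; [lia|].
    exists (fun i => c0 i + val (S N) * c i). intros x. cbn [sum_f_R0].
    rewrite H0, Hc, scal_sum, <- sum_plus. apply sum_eq. intros; ring. }
apply H. lia.
Qed.

Lemma cell_indexP o h x : 0 < h ->
  face o h (cell_index o h x) <= x < face o h (cell_index o h x + 1).
Proof.
intros Hh. unfold face, cell_index. rewrite plus_IZR.
destruct (base_Int_part ((x - o) / h + / 2)) as [H1 H2].
set (z := IZR (Int_part _)) in *.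
assert (E : x = o + ((x - o) / h) * h) by (field; lra).
set (w := (x - o) / h) in *. clearbody z w; rewrite E; split; nra.
Qed.

(* Main.v *)
Require Import Defs.
From Stdlib Require Import Reals ZArith List Lra Lia.
From Coquelicot Require Import Coquelicot.

Open Scope R_scope.

(* Let P = (x0, y0) be the centre of a cell, (xc, yc) the foot at tn of its
   characteristic, and G = (G1, G2) the foot map.  As div a = 0, G preserves
   area and f(., tn+1) = f(., tn) o G, so the exact average is
   f(xc, yc, tn) + O(h^2).

   The operator T is bounded in the sup norm and exact on cell averages of
   affine functions, so every datum may be replaced by its affine Taylor
   polynomial, up to a relative error O(h^2).  Differentiating
   p (G1 x y) y = G2 x y and using area preservation gives
   dp/dy = 1 / dG1/dx; hence dp/dy has a second order Taylor expansion although
   p itself is only C^2.  The first sweep therefore produces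
   m_I / h = h (A + B (x - xc)) + O(h^3) with A = f(xc, yc, tn) / dG1/dx(P).
   The second sweep integrates this over an interval of length
   h dG1/dx(P) + O(h^3) whose midpoint is xc + O(h^2): the slope B drops out
   and the mass is h^2 f(xc, yc, tn) + O(h^4). *)

(** * The reconstruction operator *)

(** The order count shapes the proof. An error O(h^2) in an average is O(h^4) in a cell mass of size
    h^2, so the width of an intermediate cell, itself of size h, must be known up to O(h^3). From p
    of class C^2 alone, dp/dy has an affine expansion with error o(h), which would leave o(h) in the
    end; the implicit representation of dp/dy through the C^2 function dG1/dx supplies the missing
    order. Constant models of the data would leave a relative error O(h), so the linear terms are
    carried along, with the same coefficients for all columns of a stencil, until they cancel by
    symmetry. All constants must be uniform in the cell: the centres lie in one fixed box, their
    feet in another, and every bound is taken over such boxes. The inverse of G1 in its first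
    variable is not assumed continuous; strict monotonicity of G1 takes the place of continuity. *)

Lemma poly_factor n (c : nat -> R) r : exists c' : nat -> R, forall x,
  sum_f_R0 (fun i => c i * x ^ i) (S n)
  = sum_f_R0 (fun i => c i * r ^ i) (S n)
    + (x - r) * sum_f_R0 (fun i => c' i * x ^ i) n.
Proof.
revert c. induction n as [|n IH]; intros c.
- exists (fun _ => c 1%nat). intros x. simpl. ring.
- destruct (IH (fun i => c (S i))) as [c' Hc'].
  (* Horner's scheme: the constant coefficient of the quotient is the value at r of the shifted
     polynomial. *)
  exists (fun i => match i with
    O => sum_f_R0 (fun i => c (S i) * r ^ i) (S n) | S i' => c' i' end).
  assert (E : forall y, sum_f_R0 (fun i => c i * y ^ i) (S (S n))
            = c 0%nat + y * sum_f_R0 (fun i => c (S i) * y ^ i) (S n)).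
  { intros y. rewrite decomp_sum by lia. simpl Nat.pred.
    rewrite scal_sum. simpl pow at 1. f_equal; [ring|].
    apply sum_eq. intros; simpl; ring. }
  intros x. rewrite !E, (Hc' x).
  rewrite (decomp_sum (fun i => match i with O => _ | S _ => _ end * x ^ i))
    by lia. simpl Nat.pred.
  rewrite (sum_eq (fun i => c' i * x ^ S i) (fun i => c' i * x ^ i * x) n)
    by (intros; simpl; ring).
  rewrite <- scal_sum. simpl pow. ring.
Qed.

Lemma poly_roots_zero n (c : nat -> R) (node : nat -> R) :
  (forall i j, (i <= n)%nat -> (j <= n)%nat -> i <> j -> node i <> node j) ->
  (forall k, (k <= n)%nat -> sum_f_R0 (fun i => c i * node k ^ i) n = 0) ->
  forall x, sum_f_R0 (fun i => c i * x ^ i) n = 0.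
Proof.
revert c. induction n as [|n IH]; intros c Hn Hr x.
- specialize (Hr 0%nat (le_n 0)). simpl in *. lra.
- destruct (poly_factor n c (node (S n))) as [c' Hc'].
  assert (H0 := Hr (S n) (le_n _)).
  rewrite Hc', H0, IH; [ring| |].
  + intros i j Hi Hj. apply Hn; lia.
  + intros k Hk.
    assert (Hrk := Hr k ltac:(lia)). rewrite Hc', H0 in Hrk.
    assert (Hnk := Hn k (S n) ltac:(lia) ltac:(lia) ltac:(lia)).
    destruct (Rmult_integral (node k - node (S n))
                (sum_f_R0 (fun i => c' i * node k ^ i) n)); lra.
Qed.

(** Both sides are polynomials of degree at most n that agree at n + 1 distinct nodes, so
    [poly_roots_zero] applies to the differences of their coefficients. *)
Lemma lagrange_exact n (node c : nat -> R) x :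
  (forall i j, (i <= n)%nat -> (j <= n)%nat -> i <> j -> node i <> node j) ->
  lagrange n node (fun k => sum_f_R0 (fun i => c i * node k ^ i) n) x
  = sum_f_R0 (fun i => c i * x ^ i) n.
Proof.
intros Hn.
set (v := fun k => sum_f_R0 (fun i => c i * node k ^ i) n).
destruct (lagrange_poly n node v) as [b Hb].
assert (Hd : forall y, sum_f_R0 (fun i => (b i - c i) * y ^ i) n
  = lagrange n node v y - sum_f_R0 (fun i => c i * y ^ i) n).
{ intros y. rewrite Hb, <- minus_sum. apply sum_eq. intros; ring. }
assert (H := poly_roots_zero n (fun i => b i - c i) node Hn).
cbv beta in H. apply Rminus_diag_uniq. rewrite <- Hd. apply H.
intros k Hk. rewrite Hd, lagrange_node by auto. unfold v. ring.
Qed.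

Lemma lagrange_plus n node v w x :
  lagrange n node (fun k => v k + w k) x
  = lagrange n node v x + lagrange n node w x.
Proof.
unfold lagrange. rewrite <- sum_plus. apply sum_eq. intros; ring.
Qed.

Lemma lagrange_ext n node v w x :
  (forall k, v k = w k) -> lagrange n node v x = lagrange n node w x.
Proof. intros H. apply sum_eq. intros. now rewrite H. Qed.

(** Every factor is a quotient of two lengths of order h, so the mesh width cancels and the bound
    survives refinement. The skipped factor is 1, whence 1 <= L. *)
Lemma lagrange_basis_bound n node k x L h :
  0 < h -> 1 <= L ->
  (forall m, (m <= n)%nat -> Rabs (x - node m) <= L * h) ->
  (forall m, (m <= n)%nat -> m <> k -> h <= Rabs (node k - node m)) ->
  Rabs (lagrange_basis n node k x) <= L ^ S n.
Proof.
intros Hh HL Hx Hd. unfold lagrange_basis.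
(* The exponent becomes the length of the list of factors, which makes the claim inductive in that
   list. *)
rewrite <- (length_seq (S n) 0) at 2.
assert (H : forall m, In m (seq 0 (S n)) -> (m <= n)%nat).
{ intros m Hm. apply in_seq in Hm. lia. }
revert H. generalize (seq 0 (S n)) as s.
induction s as [|m s IH]; intros Hs; simpl.
- rewrite Rabs_R1. lra.
- rewrite Rabs_mult. apply Rmult_le_compat; try apply Rabs_pos.
  + destruct (Nat.eqb_spec m k) as [_|e]; [rewrite Rabs_R1; lra|].
    assert (Hm : (m <= n)%nat) by (apply Hs; left; reflexivity).
    specialize (Hx m Hm). specialize (Hd m Hm e).
    rewrite Rabs_div by (intros E; rewrite E, Rabs_R0 in Hd; lra).
    apply Rle_div_l; [lra|]. nra.
  + apply IH. intros i Hi. apply Hs. right; exact Hi.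
Qed.

Lemma sum_f_R0_const_bound (u : nat -> R) n M :
  (forall k, (k <= n)%nat -> Rabs (u k) <= M) ->
  Rabs (sum_f_R0 u n) <= INR (S n) * M.
Proof.
induction n as [|n IH]; intros H.
- simpl. specialize (H 0%nat (le_n _)). lra.
- rewrite tech5, S_INR.
  assert (H1 := H (S n) (le_n _)).
  assert (H2 : Rabs (sum_f_R0 u n) <= INR (S n) * M)
    by (apply IH; intros; apply H; lia).
  pose proof (Rabs_triang (sum_f_R0 u n) (u (S n))). lra.
Qed.

Lemma Zsum_plus u v a b : Zsum (fun c => u c + v c) a b = Zsum u a b + Zsum v a b.
Proof.
unfold Zsum. induction (seq 0 (Z.to_nat (b - a))) as [|m s IH]; simpl; [ring|].
rewrite IH. ring.
Qed.

Lemma Zsum_ext u v a b : (forall c, u c = v c) -> Zsum u a b = Zsum v a b.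
Proof.
intros H. unfold Zsum. f_equal. apply map_ext. intros; apply H.
Qed.

Lemma Zsum_bound u a b M : 0 <= M ->
  (forall c, (a <= c < b)%Z -> Rabs (u c) <= M) ->
  Rabs (Zsum u a b) <= INR (Z.to_nat (b - a)) * M.
Proof.
intros HM H. unfold Zsum.
assert (Hs : forall m, In m (seq 0 (Z.to_nat (b - a))) ->
  Rabs (u (a + Z.of_nat m)%Z) <= M).
{ intros m Hm. apply in_seq in Hm. apply H. lia. }
rewrite <- (length_seq (Z.to_nat (b - a)) 0) at 2.
revert Hs. generalize (seq 0 (Z.to_nat (b - a))) as s.
induction s as [|m s IH]; intros Hs.
- simpl. rewrite Rabs_R0. lra.
- cbn [map fold_right length]. rewrite S_INR.
  assert (H1 := Hs m (or_introl eq_refl)).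
  assert (H2 := IH (fun i Hi => Hs i (or_intror Hi))).
  eapply Rle_trans; [apply Rabs_triang|]. lra.
Qed.

Lemma Zsum_telescope (P : Z -> R) a b : (a <= b)%Z ->
  Zsum (fun c => P (c + 1)%Z - P c) a b = P b - P a.
Proof.
intros Hab. unfold Zsum.
assert (E : forall n s, fold_right Rplus 0
    (map (fun m => P (a + Z.of_nat m + 1)%Z - P (a + Z.of_nat m)%Z) (seq s n))
  = P (a + Z.of_nat (s + n))%Z - P (a + Z.of_nat s)%Z).
{ induction n as [|n IH]; intros s; simpl.
  - replace (s + 0)%nat with s by lia. ring.
  - rewrite IH. replace (a + Z.of_nat s + 1)%Z with (a + Z.of_nat (S s))%Z by lia.
    replace (s + S n)%nat with (S s + n)%nat by lia. ring. }
rewrite E. f_equal; f_equal; [|f_equal]; lia.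
Qed.

Lemma Zsum_nil u a b : (b <= a)%Z -> Zsum u a b = 0.
Proof.
intros H. unfold Zsum. replace (Z.to_nat (b - a)) with 0%nat by lia. reflexivity.
Qed.

Lemma primitive_at_telescope h (g P : _) j k :
  (forall c, h * g c = P (c + 1)%Z - P c) ->
  primitive_at h g j k = P (j + k)%Z - P j.
Proof.
intros H. unfold primitive_at.
rewrite !(Zsum_ext _ _ _ _ H).
destruct (Z_le_gt_dec 0 k).
- rewrite Zsum_telescope, Zsum_nil by lia. ring.
- rewrite Zsum_nil, Zsum_telescope by lia. ring.
Qed.

Lemma primitive_at_plus h u v j k :
  primitive_at h (fun c => u c + v c) j k
  = primitive_at h u j k + primitive_at h v j k.
Proof.
unfold primitive_at.
rewrite !(Zsum_ext (fun c => h * (u c + v c)) (fun c => h * u c + h * v c))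
  by (intros; ring).
rewrite !Zsum_plus. ring.
Qed.

(** At most D + 1 cells separate face j from a node: D to its left, or D + 1, cell j included, to
    its right. *)
Lemma primitive_at_bound h g j k (D : nat) e :
  0 < h -> 0 <= e -> (- Z.of_nat D <= k <= Z.of_nat D + 1)%Z ->
  (forall c, (j - Z.of_nat D <= c <= j + Z.of_nat D)%Z -> Rabs (g c) <= e) ->
  Rabs (primitive_at h g j k) <= INR (S D) * (h * e).
Proof.
intros Hh He Hk Hg. unfold primitive_at.
assert (Hge : forall c, (j - Z.of_nat D <= c <= j + Z.of_nat D)%Z ->
  Rabs (h * g c) <= h * e).
{ intros c Hc. rewrite Rabs_mult, (Rabs_pos_eq h) by lra.
  apply Rmult_le_compat_l; [lra|auto]. }
assert (Hhe : 0 <= h * e) by nra.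
assert (L : forall n, (n <= S D)%nat -> INR n * (h * e) <= INR (S D) * (h * e)).
{ intros n Hn. apply Rmult_le_compat_r; [lra|]. apply le_INR. exact Hn. }
destruct (Z_le_gt_dec 0 k).
- rewrite (Zsum_nil _ (j + k) j), Rminus_0_r by lia.
  eapply Rle_trans; [apply (Zsum_bound _ _ _ (h * e)); [lra|]|].
  + intros c Hc. apply Hge. lia.
  + apply L. lia.
- rewrite (Zsum_nil _ j (j + k)), Rminus_0_l, Rabs_Ropp by lia.
  eapply Rle_trans; [apply (Zsum_bound _ _ _ (h * e)); [lra|]|].
  + intros c Hc. apply Hge. lia.
  + apply L. lia.
Qed.

Lemma face_succ o h i : face o h (i + 1) = face o h i + h.
Proof. unfold face. rewrite plus_IZR. ring. Qed.

Lemma face_add o h i k : face o h (i + k) = face o h i + IZR k * h.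
Proof. unfold face. rewrite plus_IZR. ring. Qed.

Lemma node_distinct o h j d : 0 < h ->
  forall i k : nat, i <> k ->
  h <= Rabs (face o h (j + (Z.of_nat i - Z.of_nat d))
             - face o h (j + (Z.of_nat k - Z.of_nat d))).
Proof.
intros Hh i k Hik. rewrite !face_add.
replace (_ - _) with (IZR (Z.of_nat i - Z.of_nat k) * h)
  by (rewrite !minus_IZR; ring).
rewrite Rabs_mult, (Rabs_pos_eq h), <- abs_IZR by lra.
assert (1 <= IZR (Z.abs (Z.of_nat i - Z.of_nat k))) by (apply IZR_le; lia).
nra.
Qed.

(** The data are averages of an affine function, that is, its values at the cell centres. Their
    primitive is quadratic, and d >= 1 makes the degree 2 d + 1 large enough to reproduce it. *)
Lemma primitive_interp_affine d o h A B xc j x :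
  (1 <= d)%nat -> 0 < h ->
  primitive_interp d o h (fun c => A + B * (face o h c + h / 2 - xc)) j x
  = (A * x + B * (x - xc) ^ 2 / 2)
    - (A * face o h j + B * (face o h j - xc) ^ 2 / 2).
Proof.
intros Hd Hh. unfold primitive_interp.
set (Q := fun x => A * x + B * (x - xc) ^ 2 / 2).
match goal with |- _ = ?r => change r with (Q x - Q (face o h j)) end.
rewrite (lagrange_ext _ _ _ (fun k =>
  Q (face o h (j + (Z.of_nat k - Z.of_nat d))) - Q (face o h j))).
2:{ intros k.
  rewrite (primitive_at_telescope _ _ (fun c => Q (face o h c))); [reflexivity|].
  intros c. rewrite face_succ. unfold Q. field. }
(* The monomial coefficients of Q minus its value at face j, padded with zeros up to degree 2 d +
   1. *)
destruct (poly_le 2 (2 * d + 1) (fun i => match i with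
   | O => B * xc ^ 2 / 2 - Q (face o h j) | 1%nat => A - B * xc
   | _ => B / 2 end)) as [c Hc]; [lia|].
assert (E : forall y, Q y - Q (face o h j)
             = sum_f_R0 (fun i => c i * y ^ i) (2 * d + 1)).
{ intros y. rewrite <- Hc. simpl. set (q := Q (face o h j)). unfold Q. field. }
rewrite E.
rewrite (lagrange_ext _ _ _ _ x (fun k => E _)).
apply lagrange_exact.
intros i k _ _ Hik He.
assert (H := node_distinct o h j d Hh i k Hik).
rewrite He, Rminus_diag, Rabs_R0 in H by reflexivity. lra.
Qed.

Lemma primitive_interp_plus d o h u v j x :
  primitive_interp d o h (fun c => u c + v c) j x
  = primitive_interp d o h u j x + primitive_interp d o h v j x.
Proof.
unfold primitive_interp. rewrite <- lagrange_plus.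
apply lagrange_ext. intros k. apply primitive_at_plus.
Qed.

Lemma primitive_interp_ext d o h u v j x : (forall c, u c = v c) ->
  primitive_interp d o h u j x = primitive_interp d o h v j x.
Proof.
intros H. apply lagrange_ext. intros k. unfold primitive_at.
rewrite !(Zsum_ext (fun c => h * u c) (fun c => h * v c)); auto;
  intros; now rewrite H.
Qed.

Lemma primitive_interp_bound d : exists C, 0 <= C /\
  forall o h g j x e, 0 < h -> 0 <= e ->
  face o h j <= x <= face o h j + h ->
  (forall c, (j - Z.of_nat d <= c <= j + Z.of_nat d)%Z -> Rabs (g c) <= e) ->
  Rabs (primitive_interp d o h g j x) <= C * (h * e).
Proof.
(* From a point of cell j, each of the faces j - d, ..., j + d + 1 is at most d + 1 cell widths
   away. *)
set (L := INR d + 1).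
assert (HL : 1 <= L) by (unfold L; pose proof (pos_INR d); lra).
(* Number of nodes, times the number of cells in a primitive value, times the bound of a basis
   polynomial. *)
exists (INR (S (2 * d + 1)) * (INR (S d) * L ^ S (2 * d + 1))).
assert (HLp : 0 <= L ^ S (2 * d + 1)) by (apply pow_le; lra).
split; [apply Rmult_le_pos; [apply pos_INR|apply Rmult_le_pos; [apply pos_INR|lra]]|].
intros o h g j x e Hh He Hx Hg. unfold primitive_interp, lagrange.
eapply Rle_trans; [apply (sum_f_R0_const_bound _ _
   (INR (S d) * (h * e) * L ^ S (2 * d + 1)))|right; ring].
intros k Hk. rewrite Rabs_mult.
apply Rmult_le_compat; try apply Rabs_pos.
- apply primitive_at_bound; auto. lia.
- apply (lagrange_basis_bound _ _ _ _ L h); auto.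
  + intros m Hm. rewrite face_add, minus_IZR, <- !INR_IZR_INZ.
    assert (0 <= INR m <= 2 * INR d + 1).
    { split; [apply pos_INR|]. apply le_INR in Hm.
      rewrite plus_INR, mult_INR in Hm. simpl in Hm. lra. }
    unfold L. apply Rabs_le. nra.
  + intros m Hm Hne. apply node_distinct; auto.
Qed.

(* The stencil condition is centred at [xs i]: cells further away than the
   displacement plus d + 3 cells do not enter [remap ... i]. *)
Lemma remap_estimate d K : (1 <= d)%nat -> 0 <= K -> exists C, 0 <= C /\
  forall o h xs g i A B xc e, 0 < h -> 0 <= e ->
  xs i <= xs (i + 1)%Z <= xs i + K * h ->
  (forall c, Rabs (face o h c + h / 2 - xs i) <= (K + INR d + 3) * h ->
     Rabs (g c - (A + B * (face o h c + h / 2 - xc))) <= e) ->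
  Rabs (remap d o h xs g i
        - (xs (i + 1)%Z - xs i)
          * (A + B * ((xs i + xs (i + 1)%Z) / 2 - xc))) <= C * (h * e).
Proof.
intros Hd HK.
destruct (primitive_interp_bound d) as [C [HC Hb]].
(* Two interpolated primitives contribute C each; the sum between them has at most K + 1 cells, the
   interval being no longer than K h. *)
exists (2 * C + (K + 1)). split; [lra|].
intros o h xs g i A B xc e Hh He Hxs Hg.
set (r := fun c => g c - (A + B * (face o h c + h / 2 - xc))) in *.
set (a := fun c => A + B * (face o h c + h / 2 - xc)).
assert (Eg : forall c, g c = a c + r c) by (intros; unfold a, r; ring).
unfold remap.
set (x0 := xs i) in *. set (x1 := xs (i + 1)%Z) in *.
assert (Hmu := cell_indexP o h x0 Hh). assert (Hlam := cell_indexP o h x1 Hh).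
set (mu := cell_index o h x0) in *. set (lam := cell_index o h x1) in *.
cbv zeta.
rewrite face_succ in Hmu, Hlam.
assert (Hml : (mu <= lam)%Z).
{ destruct (Z_le_gt_dec mu lam) as [|Hgt]; [assumption|exfalso].
  replace mu with (lam + (mu - lam))%Z in Hmu by lia. rewrite face_add in Hmu.
  assert (1 <= IZR (mu - lam)) by (apply IZR_le; lia). nra. }
assert (Efl : face o h lam = face o h mu + IZR (lam - mu) * h).
{ rewrite <- face_add. f_equal. lia. }
assert (Hnum : IZR (lam - mu) <= K + 1).
{ apply Rmult_le_reg_r with h; nra. }
rewrite !(primitive_interp_ext d o h g _ _ _ Eg), !primitive_interp_plus.
rewrite (Zsum_ext (fun c => h * g c) (fun c => h * a c + h * r c))
  by (intros; rewrite Eg; ring).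
rewrite Zsum_plus.
(* The affine part is exact: both interpolants reproduce Q up to a constant, and the masses in
   between telescope. *)
unfold a at 1 3. rewrite !primitive_interp_affine by assumption.
set (Q := fun x => A * x + B * (x - xc) ^ 2 / 2).
rewrite (Zsum_ext (fun c => h * a c)
  (fun c => Q (face o h (c + 1)) - Q (face o h c)))
  by (intros; rewrite face_succ; unfold Q, a; field).
rewrite (Zsum_telescope (fun c => Q (face o h c))) by assumption.
assert (Hd0 := pos_INR d).
assert (Hst : forall j x, face o h j <= x < face o h j + h -> x0 <= x <= x1 ->
  forall c, (j - Z.of_nat d <= c <= j + Z.of_nat d)%Z -> Rabs (r c) <= e).
{ intros j x Hj Hx c Hc. apply Hg.
  replace c with (j + (c - j))%Z by lia. rewrite face_add.
  assert (- INR d <= IZR (c - j) <= INR d).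
  { rewrite !INR_IZR_INZ, <- opp_IZR. split; apply IZR_le; lia. }
  assert (IZR (c - j) * h <= INR d * h) by nra.
  assert (- INR d * h <= IZR (c - j) * h) by nra.
  apply Rabs_le. nra. }
assert (B1 : Rabs (primitive_interp d o h r lam x1) <= C * (h * e)).
{ apply Hb; auto; [lra|]. apply (Hst lam x1); lra. }
assert (B0 : Rabs (primitive_interp d o h r mu x0) <= C * (h * e)).
{ apply Hb; auto; [lra|]. apply (Hst mu x0); lra. }
assert (B2 : Rabs (Zsum (fun c => h * r c) mu lam) <= (K + 1) * (h * e)).
{ assert (0 <= h * e) by nra.
  eapply Rle_trans; [apply (Zsum_bound _ _ _ (h * e)); [assumption|]|].
  - intros c Hc. rewrite Rabs_mult, (Rabs_pos_eq h) by lra.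
    apply Rmult_le_compat_l; [lra|]. apply Hg.
    replace c with (mu + (c - mu))%Z by lia. rewrite face_add.
    assert (0 <= IZR (c - mu) <= IZR (lam - mu)).
    { split; apply IZR_le; lia. }
    assert (IZR (c - mu) * h <= (K + 1) * h) by nra.
    assert (0 <= IZR (c - mu) * h) by nra.
    apply Rabs_le. nra.
  - apply Rmult_le_compat_r; [assumption|].
    rewrite INR_IZR_INZ, Z2Nat.id by lia. assumption. }
apply Rabs_le_between in B0, B1, B2.
(* [Q x1 - Q x0] is the length of the interval times the affine function at its midpoint, so only
   the contributions of r are left. *)
match goal with |- Rabs ?t <= _ => replace t with
  (primitive_interp d o h r lam x1 - primitive_interp d o h r mu x0
   + Zsum (fun c => h * r c) mu lam) by (unfold Q; field) end.
apply Rabs_le. lra.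
Qed.

(** * Taylor bounds on boxes *)

Lemma Ck_continuous k g : Ck k g -> forall x y t,
  continuous (fun z : R * R * R => g (fst (fst z)) (snd (fst z)) (snd z)) (x, y, t).
Proof. destruct k; intros H; apply H. Qed.

Lemma Ck_pred k g : Ck (S k) g -> Ck k g.
Proof.
revert g. induction k as [|k IH]; intros g [Hc (gx & gy & Dx & Dy & Cx & Cy)].
- split; auto.
- split; [exact Hc|]. exists gx, gy. auto.
Qed.

Lemma Ck2_pred k g : Ck2 (S k) g -> Ck2 k g.
Proof. apply (Ck_pred k (fun x y _ => g x y)). Qed.

Lemma continuous_comp3 {T : UniformSpace} (g : R -> R -> R -> R) (u v w : T -> R) z :
  (forall x y t, continuous
     (fun z : R * R * R => g (fst (fst z)) (snd (fst z)) (snd z)) (x, y, t)) ->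
  continuous u z -> continuous v z -> continuous w z ->
  continuous (fun z => g (u z) (v z) (w z)) z.
Proof.
intros Hg Hu Hv Hw.
apply (continuous_comp_2 (fun z => (u z, v z)) w
         (fun q t => g (fst q) (snd q) t)); auto.
- apply (continuous_comp_2 u v (fun a b => (a, b))); auto.
  apply (continuous_ext (fun q => q)); [intros [a b]; reflexivity|].
  apply continuous_id.
Qed.

Lemma Ck_slice k g t : Ck k g -> Ck2 k (fun x y => g x y t).
Proof.
unfold Ck2. revert g. induction k as [|k IH]; intros g [Hc H]; split; auto.
1,2: intros x y s.
1,2: apply (continuous_comp3 g (fun z => fst (fst z)) (fun z => snd (fst z))
  (fun _ => t)); auto.
all: try apply continuous_const.
1,3: apply (continuous_comp fst fst); apply continuous_fst.
1,2: apply (continuous_comp fst snd); [apply continuous_fst|apply continuous_snd].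
destruct H as (gx & gy & Dx & Dy & Cx & Cy).
exists (fun x y _ => gx x y t), (fun x y _ => gy x y t). auto.
Qed.

Lemma Ck2_continuity_2d k g : Ck2 k g -> forall x y, continuity_2d_pt g x y.
Proof.
intros H x y. apply continuity_2d_pt_filterlim.
apply (continuous_comp3 (fun x y _ => g x y) fst snd (fun _ : R * R => 0)).
- apply (Ck_continuous k (fun x y _ => g x y)). exact H.
- apply continuous_fst.
- apply continuous_snd.
- apply continuous_const.
Qed.

Lemma Ck2_derivatives k g : Ck2 (S k) g -> exists gx gy,
  (forall x y, is_derive (fun u => g u y) x (gx x y)) /\
  (forall x y, is_derive (fun v => g x v) y (gy x y)) /\
  Ck2 k gx /\ Ck2 k gy.
Proof.
intros [_ (gx & gy & Dx & Dy & Cx & Cy)].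
exists (fun x y => gx x y 0), (fun x y => gy x y 0).
split; [intros; apply Dx|split; [intros; apply Dy|split]]; apply Ck_slice; auto.
Qed.

(* Uniform continuity turns a path of n steps from the origin into a bound of
   size n. *)
Lemma box_bounded g R0 : (forall x y, continuity_2d_pt g x y) ->
  exists M, 0 <= M /\ forall x y, Rabs x <= R0 -> Rabs y <= R0 -> Rabs (g x y) <= M.
Proof.
intros Hg.
destruct (uniform_continuity_2d g (-R0) R0 (-R0) R0 (fun x y _ _ => Hg x y)
            (mkposreal 1 Rlt_0_1)) as [[dl Hdl] Huc]; simpl in Huc.
destruct (nfloor_ex (Rabs R0 / dl)) as [n [_ Hn]].
{ apply Rdiv_le_0_compat; [apply Rabs_pos|exact Hdl]. }
set (N := INR n + 1) in *.
assert (HN : 0 < N) by (unfold N; pose proof (pos_INR n); lra).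
exists (Rabs (g 0 0) + INR (n + 1)).
split; [pose proof (Rabs_pos (g 0 0)); pose proof (pos_INR (n+1)); lra|].
intros x y Hx Hy.
assert (HR : Rabs R0 / N < dl).
{ apply Rlt_div_l; [lra|]. apply Rlt_div_l in Hn; [lra|lra]. }
assert (HR0 : 0 <= R0) by (pose proof (Rabs_pos x); lra).
rewrite Rabs_pos_eq in HR by lra.
assert (Hin : forall z s, Rabs z <= R0 -> 0 <= s <= N -> - R0 <= s / N * z <= R0).
{ intros z s Hz Hs. assert (0 <= s / N <= 1).
  { split; [apply Rdiv_le_0_compat; lra|apply Rle_div_l; lra]. }
  apply Rabs_le_between. rewrite Rabs_mult, (Rabs_pos_eq (s / N)) by lra.
  pose proof (Rabs_pos z). nra. }
assert (Hst : forall z s, Rabs z <= R0 -> Rabs ((s + 1) / N * z - s / N * z) < dl).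
{ intros z s Hz. replace (_ - _) with (z / N) by (field; lra).
  rewrite Rabs_div, (Rabs_pos_eq N) by lra.
  eapply Rle_lt_trans; [|exact HR]. apply Rmult_le_compat_r; [|exact Hz].
  left. apply Rinv_0_lt_compat; lra. }
assert (Hk : forall k, (k <= n + 1)%nat ->
  Rabs (g (INR k / N * x) (INR k / N * y)) <= Rabs (g 0 0) + INR k).
{ induction k as [|k IH]; intros Hk.
  - simpl. replace (0 / N * x) with 0 by (field; lra).
    replace (0 / N * y) with 0 by (field; lra). lra.
  - assert (0 <= INR k /\ INR (S k) <= N).
    { split; [apply pos_INR|]. apply le_INR in Hk. rewrite plus_INR in Hk. exact Hk. }
    rewrite S_INR in *.
    assert (H1 := Huc (INR k / N * x) (INR k / N * y)
      ((INR k + 1) / N * x) ((INR k + 1) / N * y)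
      ltac:(apply Hin; lra) ltac:(apply Hin; lra)
      ltac:(apply Hin; lra) ltac:(apply Hin; lra)
      ltac:(apply Hst; lra) ltac:(apply Hst; lra)).
    specialize (IH ltac:(lia)).
    match type of H1 with Rabs (?a - ?b) < _ =>
      replace a with ((a - b) + b) by ring;
      pose proof (Rabs_triang (a - b) b) end. lra. }
specialize (Hk (n + 1)%nat (le_n _)).
rewrite plus_INR in Hk. simpl (INR 1) in Hk. fold N in Hk.
rewrite Rdiv_diag, !Rmult_1_l in Hk by lra.
rewrite plus_INR. exact Hk.
Qed.

Lemma mean_value (f df : R -> R) a b :
  (forall x, Rmin a b <= x <= Rmax a b -> is_derive f x (df x)) ->
  exists c, Rmin a b <= c <= Rmax a b /\ f b - f a = df c * (b - a).
Proof.
intros H. apply (MVT_gen f a b df).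
- intros x Hx. apply H. lra.
- intros x Hx. apply continuity_pt_filterlim. apply (ex_derive_continuous (K := R_AbsRing) (V := R_NormedModule) f).
  exists (df x). apply H. exact Hx.
Qed.

Lemma between_box a b c R0 : Rabs a <= R0 -> Rabs b <= R0 ->
  Rmin a b <= c <= Rmax a b -> Rabs c <= R0.
Proof.
intros Ha Hb. apply Rabs_le_between in Ha, Hb. intros Hc. apply Rabs_le.
unfold Rmin, Rmax in Hc. destruct (Rle_dec a b); lra.
Qed.

Lemma between_dist a b c : Rmin a b <= c <= Rmax a b -> Rabs (c - a) <= Rabs (b - a).
Proof.
unfold Rmin, Rmax. destruct (Rle_dec a b); intros H.
- rewrite !Rabs_pos_eq; lra.
- rewrite !Rabs_left1; lra.
Qed.

Lemma derive_bound_abs (f df : R -> R) a b M :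
  (forall x, Rmin a b <= x <= Rmax a b -> is_derive f x (df x)) ->
  (forall x, Rmin a b <= x <= Rmax a b -> Rabs (df x) <= M) ->
  Rabs (f b - f a) <= M * Rabs (b - a).
Proof.
intros Hd HM. destruct (mean_value f df a b Hd) as [c [Hc ->]].
rewrite Rabs_mult. apply Rmult_le_compat_r; [apply Rabs_pos|auto].
Qed.

Lemma Ck2_lipschitz g R0 : Ck2 1 g -> exists M, 0 <= M /\
  forall x y x' y', Rabs x <= R0 -> Rabs y <= R0 -> Rabs x' <= R0 -> Rabs y' <= R0 ->
  Rabs (g x' y' - g x y) <= M * (Rabs (x' - x) + Rabs (y' - y)).
Proof.
intros Hg. destruct (Ck2_derivatives _ _ Hg) as (gx & gy & Dx & Dy & Cx & Cy).
destruct (box_bounded gx R0 (Ck2_continuity_2d _ _ Cx)) as [M1 [HM1 B1]].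
destruct (box_bounded gy R0 (Ck2_continuity_2d _ _ Cy)) as [M2 [HM2 B2]].
exists (M1 + M2). split; [lra|]. intros x y x' y' Hx Hy Hx' Hy'.
assert (E1 := derive_bound_abs (fun u => g u y') (fun u => gx u y') x x' M1
  ltac:(auto) (fun u Hu => B1 u y' (between_box _ _ _ _ Hx Hx' Hu) Hy')).
assert (E2 := derive_bound_abs (fun v => g x v) (fun v => gy x v) y y' M2
  ltac:(auto) (fun v Hv => B2 x v Hx (between_box _ _ _ _ Hy Hy' Hv))).
cbv beta in E1, E2.
replace (g x' y' - g x y) with ((g x' y' - g x y') + (g x y' - g x y)) by ring.
eapply Rle_trans; [apply Rabs_triang|].
pose proof (Rabs_pos (x' - x)). pose proof (Rabs_pos (y' - y)). nra.
Qed.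

(** The mean value theorem along the two-leg path through (x, y') reduces the remainder to
    increments of the first derivatives, which are Lipschitz on the box. The path and its
    intermediate points stay in the box. *)
Lemma Ck2_taylor g gx gy R0 : Ck2 2 g ->
  (forall x y, is_derive (fun u => g u y) x (gx x y)) ->
  (forall x y, is_derive (fun v => g x v) y (gy x y)) ->
  exists M, 0 <= M /\
  forall x y x' y', Rabs x <= R0 -> Rabs y <= R0 -> Rabs x' <= R0 -> Rabs y' <= R0 ->
  Rabs (gx x y) <= M /\ Rabs (gy x y) <= M /\
  Rabs (g x' y' - (g x y + gx x y * (x' - x) + gy x y * (y' - y)))
  <= M * (Rabs (x' - x) + Rabs (y' - y)) ^ 2.
Proof.
intros Hg Dx Dy.
destruct (Ck2_derivatives _ _ Hg) as (gx' & gy' & Dx' & Dy' & Cx & Cy).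
assert (Ex : forall x y, gx' x y = gx x y).
{ intros x y. rewrite <- (is_derive_unique _ _ _ (Dx x y)).
  symmetry. apply is_derive_unique. apply Dx'. }
assert (Ey : forall x y, gy' x y = gy x y).
{ intros x y. rewrite <- (is_derive_unique _ _ _ (Dy x y)).
  symmetry. apply is_derive_unique. apply Dy'. }
destruct (Ck2_lipschitz gx' R0 Cx) as [M1 [HM1 L1]].
destruct (Ck2_lipschitz gy' R0 Cy) as [M2 [HM2 L2]].
destruct (box_bounded gx' R0 (Ck2_continuity_2d _ _ Cx)) as [M3 [HM3 B3]].
destruct (box_bounded gy' R0 (Ck2_continuity_2d _ _ Cy)) as [M4 [HM4 B4]].
exists (M1 + M2 + M3 + M4). split; [lra|]. intros x y x' y' Hx Hy Hx' Hy'.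
rewrite <- !Ex, <- !Ey.
split; [specialize (B3 x y Hx Hy); lra|].
split; [specialize (B4 x y Hx Hy); lra|].
destruct (mean_value (fun u => g u y') (fun u => gx' u y') x x') as [c [Hc Ec]];
  [auto|].
destruct (mean_value (fun v => g x v) (fun v => gy' x v) y y') as [e [He Ee]];
  [auto|].
cbv beta in Ec, Ee.
match goal with |- Rabs ?t <= _ => replace t with
  ((gx' c y' - gx' x y) * (x' - x) + (gy' x e - gy' x y) * (y' - y)) by lra end.
assert (A1 := L1 x y c y' Hx Hy (between_box _ _ _ _ Hx Hx' Hc) Hy').
assert (A2 := L2 x y x e Hx Hy Hx (between_box _ _ _ _ Hy Hy' He)).
apply between_dist in Hc. apply between_dist in He.
rewrite Rminus_diag, Rabs_R0, Rplus_0_l in A2 by reflexivity.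
eapply Rle_trans; [apply Rabs_triang|]. rewrite !Rabs_mult.
set (p := Rabs (x' - x)) in *. set (q := Rabs (y' - y)) in *.
assert (0 <= p) by apply Rabs_pos. assert (0 <= q) by apply Rabs_pos.
set (r := Rabs (c - x)) in *. set (s := Rabs (e - y)) in *.
apply Rle_trans with (M1 * (p + q) * p + M2 * q * q).
- apply Rplus_le_compat; apply Rmult_le_compat_r; auto; nra.
- assert (0 <= p * q) by nra. assert (0 <= p * p) by nra. assert (0 <= q * q) by nra.
  assert (0 <= M1 * (p * q)) by nra. assert (0 <= M1 * (q * q)) by nra.
  assert (0 <= M2 * (p * q)) by nra. assert (0 <= M2 * (p * p)) by nra.
  assert (0 <= (M3+M4) * (p+q)^2) by (apply Rmult_le_pos; nra). nra.
Qed.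

(** The slope is taken about the midpoint and integrates to zero, so B needs no bound. *)
Lemma RInt_affine_bound phi a h A B e : 0 <= h -> ex_RInt phi a (a + h) ->
  (forall x, a <= x <= a + h ->
     Rabs (phi x - (A + B * (x - (a + h / 2)))) <= e) ->
  Rabs (RInt phi a (a + h) - h * A) <= h * e.
Proof.
intros Hh Hphi He.
set (L := fun x => A + B * (x - (a + h / 2))).
assert (HL : is_RInt L a (a + h) (h * A)).
{ evar_last.
  - apply (is_RInt_derive (fun x => A * x + B * (x - (a + h / 2)) ^ 2 / 2) L).
    + intros x _. unfold L. auto_derive; [auto|]. field.
    + intros x _. unfold L. apply (ex_derive_continuous (K := R_AbsRing) (V := R_NormedModule)). auto_derive. auto.
  - unfold minus, plus, opp; simpl. field. }
assert (HI : is_RInt (fun x => minus (phi x) (L x)) a (a + h)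
               (minus (RInt phi a (a + h)) (h * A))).
{ apply (is_RInt_minus (V := R_NormedModule)); [|exact HL]. apply (RInt_correct (V := R_CompleteNormedModule)). exact Hphi. }
change (RInt phi a (a + h) - h * A) with (minus (RInt phi a (a + h)) (h * A)).
replace (h * e) with ((a + h - a) * e) by ring.
apply (norm_RInt_le_const (V := R_NormedModule) (fun x => minus (phi x) (L x)) a (a + h) _ e); [lra| |exact HI].
exact He.
Qed.

Lemma cell_average_center g R0 : Ck2 2 g -> exists M, 0 <= M /\
  forall xm ym h k l, 0 < h <= 1 ->
  Rabs (face xm h k + h / 2) <= R0 -> Rabs (face ym h l + h / 2) <= R0 ->
  Rabs (cell_average xm ym h g k l - g (face xm h k + h / 2) (face ym h l + h / 2))
  <= M * h ^ 2.
Proof.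
intros Hg. destruct (Ck2_derivatives _ _ Hg) as (gx & gy & Dx & Dy & Cx & Cy).
(* Only the centre lies in the box of size R0; as h <= 1, the whole cell lies in the enlarged
   box. *)
destruct (Ck2_taylor g gx gy (R0 + 1) Hg Dx Dy) as [M [HM T]].
exists M. split; [exact HM|]. intros xm ym h k l Hh Hcx Hcy.
unfold cell_average.
replace (face xm h (k + 1)) with (face xm h k + h)
  by (unfold face; rewrite plus_IZR; ring).
replace (face ym h (l + 1)) with (face ym h l + h)
  by (unfold face; rewrite plus_IZR; ring).
set (x0 := face xm h k) in *. set (y0 := face ym h l) in *.
set (cx := x0 + h / 2) in *. set (cy := y0 + h / 2) in *.
apply Rabs_le_between in Hcx, Hcy.
assert (Hex : forall y a b, ex_RInt (fun x => g x y) a b).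
{ intros y a b. apply (ex_RInt_continuous (V := R_CompleteNormedModule)).
  intros x _. apply (ex_derive_continuous (K := R_AbsRing) (V := R_NormedModule)).
  exists (gx x y). apply Dx. }
(* Integration in x leaves an affine model in y, so that [RInt_affine_bound] applies again to the
   outer integral. *)
assert (Hin : forall y, y0 <= y <= y0 + h ->
  Rabs (RInt (fun x => g x y) x0 (x0 + h) - h * (g cx cy + gy cx cy * (y - cy)))
  <= h * (M * h ^ 2)).
{ intros y Hy. apply (RInt_affine_bound _ x0 h _ (gx cx cy)); [lra|apply Hex|].
  intros x Hx. fold cx.
  destruct (T cx cy x y) as [_ [_ T']]; try (apply Rabs_le; unfold cx, cy in *; lra).
  replace (g cx cy + gy cx cy * (y - cy) + gx cx cy * (x - cx))
    with (g cx cy + gx cx cy * (x - cx) + gy cx cy * (y - cy)) by ring.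
  eapply Rle_trans; [exact T'|]. apply Rmult_le_compat_l; [exact HM|].
  apply pow_incr. split; [apply Rplus_le_le_0_compat; apply Rabs_pos|].
  assert (Rabs (x - cx) <= h / 2) by (apply Rabs_le; unfold cx; lra).
  assert (Rabs (y - cy) <= h / 2) by (apply Rabs_le; unfold cy; lra). lra. }
assert (Hout : Rabs (RInt (fun y => RInt (fun x => g x y) x0 (x0 + h)) y0 (y0 + h)
   - h * (h * g cx cy)) <= h * (h * (M * h ^ 2))).
{ apply (RInt_affine_bound _ y0 h _ (h * gy cx cy)); [lra| |].
  (* Differentiation under the integral sign makes the inner integral continuous in y, hence
     integrable. *)
  - apply (ex_RInt_continuous (V := R_CompleteNormedModule)). intros y _.
    apply (ex_derive_continuous (K := R_AbsRing) (V := R_NormedModule)).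
    eexists. apply (is_derive_RInt_param (fun y x => g x y)).
    + apply filter_forall. intros v x _. exists (gy x v). apply Dy.
    + intros x _.
      apply (continuity_2d_pt_ext (fun v u => gy u v)).
      { intros v u. symmetry. apply is_derive_unique. apply Dy. }
      intros eps. destruct (Ck2_continuity_2d _ _ Cy x y eps) as [dl Hd].
      exists dl. intros v u Hv Hu. apply Hd; assumption.
    + apply filter_forall. intros v. apply Hex.
  - intros y Hy. fold cy.
    replace (h * g cx cy + h * gy cx cy * (y - cy))
      with (h * (g cx cy + gy cx cy * (y - cy))) by ring. auto. }
replace (/ h ^ 2 * RInt (fun y => RInt (fun x => g x y) x0 (x0 + h)) y0 (y0 + h)
         - g cx cy) with
  ((RInt (fun y => RInt (fun x => g x y) x0 (x0 + h)) y0 (y0 + h)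
   - h * (h * g cx cy)) / h ^ 2) by (field; lra).
rewrite Rabs_div, (Rabs_pos_eq (h ^ 2)) by nra.
apply Rle_div_l; nra.
Qed.

(** A form without quotients: in the chain rule, vanishing increments then need no separate case. *)
Lemma is_derive_eps (f : R -> R) x l : is_derive f x l <->
  forall eps, 0 < eps -> exists dl, 0 < dl /\
  forall y, Rabs (y - x) < dl -> Rabs (f y - f x - l * (y - x)) <= eps * Rabs (y - x).
Proof.
rewrite is_derive_Reals. split.
- intros H eps He. destruct (H eps He) as [[dl Hdl] Hd]. exists dl. split; [exact Hdl|].
  intros y Hy. destruct (Req_dec y x) as [->|Hne].
  + rewrite !Rminus_diag by reflexivity. rewrite Rmult_0_r, Rminus_0_r, Rabs_R0. lra.
  + specialize (Hd (y - x) ltac:(lra) Hy).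
    replace (x + (y - x)) with y in Hd by ring.
    replace (f y - f x - l * (y - x)) with (((f y - f x) / (y - x) - l) * (y - x))
      by (field; lra).
    rewrite Rabs_mult. apply Rmult_le_compat_r; [apply Rabs_pos|lra].
- intros H eps He. destruct (H (eps / 2) ltac:(lra)) as [dl [Hdl Hd]].
  exists (mkposreal dl Hdl). intros h Hh0 Hh. simpl in Hh.
  specialize (Hd (x + h)). replace (x + h - x) with h in Hd by ring.
  specialize (Hd Hh).
  replace ((f (x + h) - f x) / h - l) with ((f (x + h) - f x - l * h) / h)
    by (field; lra).
  rewrite Rabs_div by exact Hh0. apply Rlt_div_l; [apply Rabs_pos_lt; exact Hh0|].
  assert (0 < Rabs h) by (apply Rabs_pos_lt; exact Hh0). nra.
Qed.

Lemma continuous3_eps (g : R -> R -> R -> R) x y t :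
  continuous (fun z : R * R * R => g (fst (fst z)) (snd (fst z)) (snd z)) (x, y, t) ->
  forall eps, 0 < eps -> exists dl, 0 < dl /\
  forall x' y' t', Rabs (x' - x) < dl -> Rabs (y' - y) < dl -> Rabs (t' - t) < dl ->
  Rabs (g x' y' t' - g x y t) < eps.
Proof.
intros Hg eps He.
destruct (proj1 (filterlim_locally _ _) Hg (mkposreal eps He)) as [[dl Hdl] Hd].
exists dl. split; [exact Hdl|]. intros x' y' t' Hx Hy Ht.
apply (Hd (x', y', t')). repeat split; assumption.
Qed.

(* Only [gx] and [gy] need joint continuity: the third slot is varied first, at
   the fixed base point (u s, v s). *)
Lemma is_derive_comp3 (g gx gy : R -> R -> R -> R) (u v : R -> R) s du dv gt :
  (forall x y t, is_derive (fun z => g z y t) x (gx x y t)) ->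
  (forall x y t, is_derive (fun z => g x z t) y (gy x y t)) ->
  (forall x y t, continuous
     (fun z : R * R * R => gx (fst (fst z)) (snd (fst z)) (snd z)) (x, y, t)) ->
  (forall x y t, continuous
     (fun z : R * R * R => gy (fst (fst z)) (snd (fst z)) (snd z)) (x, y, t)) ->
  is_derive u s du -> is_derive v s dv ->
  is_derive (fun t => g (u s) (v s) t) s gt ->
  is_derive (fun t => g (u t) (v t) t) s
    (gx (u s) (v s) s * du + gy (u s) (v s) s * dv + gt).
Proof.
intros Dx Dy Cx Cy Hu Hv Ht. apply is_derive_eps. intros eps He.
set (a := gx (u s) (v s) s). set (b := gy (u s) (v s) s).
set (Ku := Rabs du + 1). set (Kv := Rabs dv + 1).
(* Each of the five error terms at the end is a multiple of e * r; S is the sum of the multiples,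
   which dictates e. *)
set (S := Rabs a + Rabs b + Ku + Kv + 1).
assert (HKu : 1 <= Ku) by (unfold Ku; pose proof (Rabs_pos du); lra).
assert (HKv : 1 <= Kv) by (unfold Kv; pose proof (Rabs_pos dv); lra).
assert (Ha := Rabs_pos a). assert (Hb := Rabs_pos b).
assert (HS : 3 <= S) by (unfold S; lra).
set (e := Rmin 1 (eps / S)).
assert (He1 : 0 < e <= 1).
{ unfold e. split; [apply Rmin_glb_lt; [lra|apply Rdiv_lt_0_compat; lra]|apply Rmin_l]. }
assert (He2 : e * S <= eps).
{ apply Rle_div_r; [lra|]. apply Rmin_r. }
destruct (continuous3_eps gx _ _ _ (Cx (u s) (v s) s) e ltac:(lra)) as [d1 [Hd1 L1]].
destruct (continuous3_eps gy _ _ _ (Cy (u s) (v s) s) e ltac:(lra)) as [d2 [Hd2 L2]].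
destruct (proj1 (is_derive_eps _ _ _) Hu e ltac:(lra)) as [d3 [Hd3 L3]].
destruct (proj1 (is_derive_eps _ _ _) Hv e ltac:(lra)) as [d4 [Hd4 L4]].
destruct (proj1 (is_derive_eps _ _ _) Ht e ltac:(lra)) as [d5 [Hd5 L5]].
set (K := Ku + Kv).
set (dl := Rmin (Rmin d1 d2) (Rmin d3 (Rmin d4 d5))).
assert (Hdl : 0 < dl) by (unfold dl; repeat apply Rmin_glb_lt; assumption).
assert (Hdls : dl <= d1 /\ dl <= d2 /\ dl <= d3 /\ dl <= d4 /\ dl <= d5).
{ unfold dl, Rmin. repeat destruct Rle_dec; lra. }
(* Over a time r, u and v move by at most Ku r and Kv r, so both increments stay below dl. *)
exists (dl / K).
assert (HK : 2 <= K) by (unfold K; lra).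
split; [apply Rdiv_lt_0_compat; lra|].
intros t Hst. apply Rlt_div_r in Hst; [|lra].
assert (Hp := Rabs_pos (t - s)). set (r := Rabs (t - s)) in *.
specialize (L3 t ltac:(unfold r in *; nra)). specialize (L4 t ltac:(unfold r in *; nra)).
specialize (L5 t ltac:(unfold r in *; nra)). fold r in L3, L4, L5.
assert (Bu : Rabs (u t - u s) <= Ku * r).
{ replace (u t - u s) with ((u t - u s - du * (t - s)) + du * (t - s)) by ring.
  eapply Rle_trans; [apply Rabs_triang|]. rewrite (Rabs_mult du). fold r.
  unfold Ku. nra. }
assert (Bv : Rabs (v t - v s) <= Kv * r).
{ replace (v t - v s) with ((v t - v s - dv * (t - s)) + dv * (t - s)) by ring.
  eapply Rle_trans; [apply Rabs_triang|]. rewrite (Rabs_mult dv). fold r.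
  unfold Kv. nra. }
destruct (mean_value (fun z => g z (v t) t) (fun z => gx z (v t) t) (u s) (u t))
  as [c [Hc Ec]]; [auto|].
destruct (mean_value (fun z => g (u s) z t) (fun z => gy (u s) z t) (v s) (v t))
  as [k [Hk Ek]]; [auto|].
cbv beta in Ec, Ek. apply between_dist in Hc. apply between_dist in Hk.
assert (A1 : Rabs (gx c (v t) t - a) < e).
{ apply L1; fold r; unfold K in *; nra. }
assert (A2 : Rabs (gy (u s) k t - b) < e).
{ apply L2; [rewrite Rminus_diag, Rabs_R0 by reflexivity; lra| |]; fold r; unfold K in *; nra. }
match goal with |- Rabs ?z <= _ => replace z with
 ((gx c (v t) t - a) * (u t - u s) + a * (u t - u s - du * (t - s))
  + ((gy (u s) k t - b) * (v t - v s) + b * (v t - v s - dv * (t - s)))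
  + (g (u s) (v s) t - g (u s) (v s) s - gt * (t - s))) by (cbv beta; lra) end.
assert (P : forall p q B1 B2, Rabs p <= B1 -> Rabs q <= B2 -> Rabs (p * q) <= B1 * B2).
{ intros p q B1 B2 Hp' Hq'. rewrite Rabs_mult. apply Rmult_le_compat; auto; apply Rabs_pos. }
apply Rle_trans with (e * (Ku * r) + Rabs a * (e * r)
  + (e * (Kv * r) + Rabs b * (e * r)) + e * r).
- repeat (eapply Rle_trans; [apply Rabs_triang|]; apply Rplus_le_compat);
  first [apply P; [lra|assumption] | assumption].
- replace (e * (Ku * r) + Rabs a * (e * r) + (e * (Kv * r) + Rabs b * (e * r)) + e * r)
   with (e * S * r) by (unfold S; ring). nra.
Qed.

(** * Area preservation and transport *)

(** The parameter x is either coordinate of the point at t1 and Y either component of the flow, so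
    four instances cover the Jacobian matrix. [Ck] asserts nothing about t-derivatives; that of Yx
    comes from the integral form. The increment of Y in time is an integral of a along the path,
    which is differentiated in x under the integral sign and then in t by the fundamental
    theorem. *)
Lemma variational_equation (a ax ay : R -> R -> R -> R)
  (X1 X2 X1x X2x Y Yx : R -> R -> R) t0 t1 :
  (forall x y t, is_derive (fun z => a z y t) x (ax x y t)) ->
  (forall x y t, is_derive (fun z => a x z t) y (ay x y t)) ->
  Ck 0 a -> Ck 0 ax -> Ck 0 ay ->
  (forall x t, is_derive (fun z => X1 z t) x (X1x x t)) ->
  (forall x t, is_derive (fun z => X2 z t) x (X2x x t)) ->
  (forall x t, is_derive (fun z => Y z t) x (Yx x t)) ->
  (forall q, continuous (fun z => X1 (fst z) (snd z)) q) ->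
  (forall q, continuous (fun z => X2 (fst z) (snd z)) q) ->
  (forall q, continuous (fun z => X1x (fst z) (snd z)) q) ->
  (forall q, continuous (fun z => X2x (fst z) (snd z)) q) ->
  (forall x t, t0 < t < t1 ->
     is_derive (fun s => Y x s) t (a (X1 x t) (X2 x t) t)) ->
  forall x t, t0 < t < t1 ->
  is_derive (fun s => Yx x s) t
    (ax (X1 x t) (X2 x t) t * X1x x t + ay (X1 x t) (X2 x t) t * X2x x t).
Proof.
intros Dax Day [Ca _] [Cax _] [Cay _] DX1 DX2 DY C1 C2 C1x C2x HY x t Ht.
set (H := fun x t => ax (X1 x t) (X2 x t) t * X1x x t
                     + ay (X1 x t) (X2 x t) t * X2x x t).
assert (CH : forall q, continuous (fun z => H (fst z) (snd z)) q).
{ intros q. unfold H.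
  apply (continuous_plus (V := R_NormedModule)
    (fun z : R * R => ax (X1 (fst z) (snd z)) (X2 (fst z) (snd z)) (snd z) * X1x (fst z) (snd z))).
  - apply (continuous_mult (fun z : R * R => ax (X1 (fst z) (snd z)) (X2 (fst z) (snd z)) (snd z))); [|apply C1x].
    apply (continuous_comp3 ax (fun z => X1 (fst z) (snd z)) (fun z => X2 (fst z) (snd z)) snd); auto.
    apply continuous_snd.
  - apply (continuous_mult (fun z : R * R => ay (X1 (fst z) (snd z)) (X2 (fst z) (snd z)) (snd z))); [|apply C2x].
    apply (continuous_comp3 ay (fun z => X1 (fst z) (snd z)) (fun z => X2 (fst z) (snd z)) snd); auto.
    apply continuous_snd. }
assert (slice : forall F : R -> R -> R, (forall q, continuous (fun z => F (fst z) (snd z)) q) ->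
  forall x' s, continuous (fun s => F x' s) s).
{ intros F CF x' s. apply (continuous_comp_2 (fun _ => x') (fun s => s) F).
  - apply continuous_const.
  - apply continuous_id.
  - apply CF. }
assert (Cas : forall x' s, continuous (fun s => a (X1 x' s) (X2 x' s) s) s).
{ intros x' s. apply (continuous_comp3 a (fun s => X1 x' s) (fun s => X2 x' s) (fun s => s)); auto.
  apply continuous_id. }
assert (Da : forall x' s, is_derive (fun z => a (X1 z s) (X2 z s) s) x' (H x' s)).
{ intros x' s. unfold H. rewrite <- Rplus_0_r.
  apply (is_derive_comp3 (fun x y _ => a x y s) (fun x y _ => ax x y s) (fun x y _ => ay x y s)
     (fun z => X1 z s) (fun z => X2 z s)); auto.
  - intros u v w. apply (continuous_comp3 ax (fun z => fst (fst z)) (fun z => snd (fst z)) (fun _ => s)); auto.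
    + apply (continuous_comp fst fst); apply continuous_fst.
    + apply (continuous_comp fst snd); [apply continuous_fst|apply continuous_snd].
    + apply continuous_const.
  - intros u v w. apply (continuous_comp3 ay (fun z => fst (fst z)) (fun z => snd (fst z)) (fun _ => s)); auto.
    + apply (continuous_comp fst fst); apply continuous_fst.
    + apply (continuous_comp fst snd); [apply continuous_fst|apply continuous_snd].
    + apply continuous_const.
  - apply (is_derive_const (V := R_NormedModule)). }
assert (Exr : forall x' c e, ex_RInt (fun s => a (X1 x' s) (X2 x' s) s) c e).
{ intros x' c e. apply (ex_RInt_continuous (V := R_CompleteNormedModule)). auto. }
assert (EY : forall x' t', t0 < t' < t1 ->
  RInt (fun s => a (X1 x' s) (X2 x' s) s) t t' = Y x' t' - Y x' t).
{ intros x' t' Ht'. apply is_RInt_unique.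
  apply (is_RInt_derive (V := R_CompleteNormedModule) (fun s => Y x' s)); auto.
  intros s Hs. apply HY. unfold Rmin, Rmax in Hs. destruct (Rle_dec t t'); lra. }
assert (EYx : forall t', t0 < t' < t1 -> Yx x t + RInt (fun s => H x s) t t' = Yx x t').
{ intros t' Ht'.
  assert (D1 : is_derive (fun x' => Y x' t' - Y x' t) x (RInt (fun s => H x s) t t')).
  { apply (is_derive_ext (fun x' => RInt (fun s => a (X1 x' s) (X2 x' s) s) t t')); [intros; auto|].
    rewrite (RInt_ext (fun s => H x s)
      (fun s => Derive (fun u => a (X1 u s) (X2 u s) s) x))
      by (intros; symmetry; apply is_derive_unique, Da).
    apply (is_derive_RInt_param (fun x' s => a (X1 x' s) (X2 x' s) s)).
    - apply filter_forall. intros x' s _. eexists. apply Da.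
    - intros s _. apply (continuity_2d_pt_ext H).
      + intros; symmetry; apply is_derive_unique, Da.
      + apply continuity_2d_pt_filterlim. apply CH.
    - apply filter_forall. auto. }
  assert (D2 : is_derive (fun x' => Y x' t' - Y x' t) x (Yx x t' - Yx x t)).
  { apply (is_derive_minus (V := R_NormedModule)); auto. }
  apply is_derive_unique in D1. apply is_derive_unique in D2. lra. }
(* The integral identity is known on the open time interval only, which is a neighbourhood of t. *)
apply (is_derive_ext_loc (fun t' => Yx x t + RInt (fun s => H x s) t t')).
{ apply (locally_interval _ t t0 t1); [simpl; lra|simpl; lra|].
  simpl. intros t' A1 A2. apply EYx. lra. }
rewrite <- (Rplus_0_l (_ + _)).
apply (is_derive_plus (V := R_NormedModule)).
- apply (is_derive_const (V := R_NormedModule)).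
- apply (is_derive_RInt (V := R_NormedModule) (fun s => H x s) _ t).
  + apply filter_forall. intros t'. apply (RInt_correct (V := R_CompleteNormedModule)).
    apply (ex_RInt_continuous (V := R_CompleteNormedModule)). intros; apply slice, CH.
  + apply slice, CH.
Qed.

(** The differential equations hold on the open interval; continuity carries conserved quantities to
    the two time levels at its ends. *)
Lemma constant_of_zero_derive (f : R -> R) a b : a < b ->
  (forall x, a < x < b -> is_derive f x 0) ->
  (forall x, a <= x <= b -> continuous f x) -> f a = f b.
Proof.
intros Hab Hd Hc.
destruct (MVT_gen f a b (fun _ => 0)) as [c [_ E]];
  rewrite ?Rmin_left, ?Rmax_right by lra; auto.
- intros x Hx. apply continuity_pt_filterlim. apply Hc, Hx.
- lra.
Qed.

Lemma Ck_continuous_path k g (u v : R -> R) s : Ck k g ->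
  continuous u s -> continuous v s -> continuous (fun s => g (u s) (v s) s) s.
Proof.
intros Hg Hu Hv. apply (continuous_comp3 g u v (fun s => s)); auto.
- apply (Ck_continuous k g Hg).
- apply continuous_id.
Qed.

Lemma Ck_continuous_time k g x y s : Ck k g -> continuous (fun s => g x y s) s.
Proof.
intros Hg. apply (Ck_continuous_path k g (fun _ => x) (fun _ => y)); auto;
apply continuous_const.
Qed.

(** Liouville's formula: the derivative of the determinant is div a times the determinant, hence
    zero, and at t1 the flow is the identity. *)
Lemma characteristics_jacobian a1 a2 X1 X2 t0 t1 x y d11 d12 d21 d22 :
  t0 < t1 -> Ck 1 a1 -> Ck 1 a2 -> divergence_free a1 a2 t0 t1 ->
  Ck 1 X1 -> Ck 1 X2 -> is_characteristics a1 a2 X1 X2 t0 t1 ->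
  is_derive (fun u => X1 u y t0) x d11 -> is_derive (fun v => X1 x v t0) y d12 ->
  is_derive (fun u => X2 u y t0) x d21 -> is_derive (fun v => X2 x v t0) y d22 ->
  d11 * d22 - d12 * d21 = 1.
Proof.
intros Ht [Ca1 (a1x & a1y & Da1x & Da1y & Ca1x & Ca1y)]
  [Ca2 (a2x & a2y & Da2x & Da2y & Ca2x & Ca2y)] Hdiv
  [CX1 (X1x & X1y & DX1x & DX1y & CX1x & CX1y)]
  [CX2 (X2x & X2y & DX2x & DX2y & CX2x & CX2y)] HX H11 H12 H21 H22.
apply is_derive_unique in H11, H12, H21, H22.
rewrite (is_derive_unique _ _ _ (DX1x _ _ _)) in H11.
rewrite (is_derive_unique _ _ _ (DX1y _ _ _)) in H12.
rewrite (is_derive_unique _ _ _ (DX2x _ _ _)) in H21.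
rewrite (is_derive_unique _ _ _ (DX2y _ _ _)) in H22.
subst d11 d12 d21 d22.
assert (Cx : forall g, Ck 0 g -> forall y q, continuous (fun z => g (fst z) y (snd z)) q).
{ intros g Hg y' q. apply (continuous_comp3 g fst (fun _ => y') snd).
  - apply (Ck_continuous 0 g Hg).
  - apply continuous_fst.
  - apply continuous_const.
  - apply continuous_snd. }
assert (Cy : forall g, Ck 0 g -> forall x q, continuous (fun z => g x (fst z) (snd z)) q).
{ intros g Hg x' q. apply (continuous_comp3 g (fun _ => x') fst snd).
  - apply (Ck_continuous 0 g Hg).
  - apply continuous_const.
  - apply continuous_fst.
  - apply continuous_snd. }
assert (C1 : Ck 0 X1) by (split; auto). assert (C2 : Ck 0 X2) by (split; auto).
assert (C1a : Ck 0 a1) by (split; auto). assert (C2a : Ck 0 a2) by (split; auto).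
assert (T11 : forall t, t0 < t < t1 -> is_derive (fun s => X1x x y s) t
  (a1x (X1 x y t) (X2 x y t) t * X1x x y t + a1y (X1 x y t) (X2 x y t) t * X2x x y t)).
{ intros t Htt. apply (variational_equation a1 a1x a1y (fun z => X1 z y) (fun z => X2 z y)
    (fun z => X1x z y) (fun z => X2x z y) (fun z => X1 z y) (fun z => X1x z y) t0 t1 ltac:(auto) ltac:(auto)); auto.
  intros; apply HX; assumption. }
assert (T21 : forall t, t0 < t < t1 -> is_derive (fun s => X2x x y s) t
  (a2x (X1 x y t) (X2 x y t) t * X1x x y t + a2y (X1 x y t) (X2 x y t) t * X2x x y t)).
{ intros t Htt. apply (variational_equation a2 a2x a2y (fun z => X1 z y) (fun z => X2 z y)
    (fun z => X1x z y) (fun z => X2x z y) (fun z => X2 z y) (fun z => X2x z y) t0 t1 ltac:(auto) ltac:(auto)); auto.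
  intros; apply HX; assumption. }
assert (T12 : forall t, t0 < t < t1 -> is_derive (fun s => X1y x y s) t
  (a1x (X1 x y t) (X2 x y t) t * X1y x y t + a1y (X1 x y t) (X2 x y t) t * X2y x y t)).
{ intros t Htt. apply (variational_equation a1 a1x a1y (fun z => X1 x z) (fun z => X2 x z)
    (fun z => X1y x z) (fun z => X2y x z) (fun z => X1 x z) (fun z => X1y x z) t0 t1 ltac:(auto) ltac:(auto)); auto.
  intros; apply HX; assumption. }
assert (T22 : forall t, t0 < t < t1 -> is_derive (fun s => X2y x y s) t
  (a2x (X1 x y t) (X2 x y t) t * X1y x y t + a2y (X1 x y t) (X2 x y t) t * X2y x y t)).
{ intros t Htt. apply (variational_equation a2 a2x a2y (fun z => X1 x z) (fun z => X2 x z)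
    (fun z => X1y x z) (fun z => X2y x z) (fun z => X2 x z) (fun z => X2y x z) t0 t1 ltac:(auto) ltac:(auto)); auto.
  intros; apply HX; assumption. }
rewrite (constant_of_zero_derive
  (fun t => X1x x y t * X2y x y t - X1y x y t * X2x x y t) t0 t1 Ht).
- assert (E1 : forall u v, X1 u v t1 = u) by (intros; apply HX).
  assert (E2 : forall u v, X2 u v t1 = v) by (intros; apply HX).
  assert (F11 : X1x x y t1 = 1).
  { rewrite <- (is_derive_unique _ _ _ (DX1x x y t1)).
    rewrite (Derive_ext _ (fun u => u)) by auto. apply Derive_id. }
  assert (F12 : X1y x y t1 = 0).
  { rewrite <- (is_derive_unique _ _ _ (DX1y x y t1)).
    rewrite (Derive_ext _ (fun _ => x)) by auto. apply Derive_const. }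
  assert (F22 : X2y x y t1 = 1).
  { rewrite <- (is_derive_unique _ _ _ (DX2y x y t1)).
    rewrite (Derive_ext _ (fun u => u)) by auto. apply Derive_id. }
  rewrite F11, F12, F22. ring.
- intros t Htt.
  assert (Hd := Hdiv (X1 x y t) (X2 x y t) t Htt).
  rewrite (is_derive_unique _ _ _ (Da1x _ _ _)) in Hd.
  rewrite (is_derive_unique _ _ _ (Da2y _ _ _)) in Hd.
  evar_last.
  + apply (is_derive_minus (V := R_NormedModule)).
    * apply (is_derive_mult _ _ t _ _ (T11 t Htt) (T22 t Htt) Rmult_comm).
    * apply (is_derive_mult _ _ t _ _ (T12 t Htt) (T21 t Htt) Rmult_comm).
  + unfold minus, plus, opp, mult; simpl.
    set (p := a1x _ _ _) in *. set (r := a2y _ _ _) in *.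
    replace r with (- p) by lra. ring.
- intros t _.
  apply (continuous_minus (V := R_NormedModule) (fun t => X1x x y t * X2y x y t)).
  + apply (continuous_mult (fun t => X1x x y t)); apply (Ck_continuous_time 0); auto.
  + apply (continuous_mult (fun t => X1y x y t)); apply (Ck_continuous_time 0); auto.
Qed.

(** Expanding the divergence of a f gives a . grad f + f div a. The second term vanishes and the
    first cancels the contribution of the motion, so f is constant along each characteristic. *)
Lemma transport_along_characteristics a1 a2 f X1 X2 t0 t1 x y :
  t0 < t1 -> Ck 1 a1 -> Ck 1 a2 -> divergence_free a1 a2 t0 t1 -> Ck 1 f ->
  solves_transport a1 a2 f t0 t1 -> Ck 0 X1 -> Ck 0 X2 ->
  is_characteristics a1 a2 X1 X2 t0 t1 ->
  f x y t1 = f (X1 x y t0) (X2 x y t0) t0.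
Proof.
intros Ht [_ (a1x & a1y & Da1x & _ & _)] [_ (a2x & a2y & _ & Da2y & _)]
  Hdiv Hf Hs CX1 CX2 HX.
destruct (HX x y) as (E1 & E2 & HXt).
transitivity (f (X1 x y t1) (X2 x y t1) t1); [now rewrite E1, E2|symmetry].
apply (constant_of_zero_derive (fun t => f (X1 x y t) (X2 x y t) t) t0 t1 Ht).
- destruct Hf as [_ (fx & fy & Dfx & Dfy & Cfx & Cfy)].
  intros t Htt. destruct (HXt t Htt) as [D1 D2].
  evar_last.
  + exact (is_derive_comp3 f fx fy (fun t => X1 x y t) (fun t => X2 x y t) t _ _ _
      Dfx Dfy (Ck_continuous 0 fx Cfx) (Ck_continuous 0 fy Cfy) D1 D2
      (Hs _ _ t Htt)).
  + assert (Hd := Hdiv (X1 x y t) (X2 x y t) t Htt).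
    rewrite (is_derive_unique _ _ _ (Da1x _ _ _)) in Hd.
    rewrite (is_derive_unique _ _ _ (Da2y _ _ _)) in Hd.
    rewrite Derive_mult, (Derive_mult (fun v => a2 _ v t)); try (eexists; eauto; fail).
    rewrite !(is_derive_unique _ _ _ (Da1x _ _ _)), !(is_derive_unique _ _ _ (Da2y _ _ _)),
      (is_derive_unique _ _ _ (Dfx _ _ _)), (is_derive_unique _ _ _ (Dfy _ _ _)).
    set (p := a1x _ _ _) in *. set (r := a2y _ _ _) in *.
    replace r with (- p) by lra. ring.
- intros t _. apply (Ck_continuous_path 1); auto; apply (Ck_continuous_time 0); auto.
Qed.

(** * Slope of the backtracked lines *)

Lemma Rabs_mult_le a b A B : Rabs a <= A -> Rabs b <= B -> Rabs (a * b) <= A * B.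
Proof.
intros Ha Hb. rewrite Rabs_mult. apply Rmult_le_compat; auto; apply Rabs_pos.
Qed.

Lemma Rabs_plus_le a b A B : Rabs a <= A -> Rabs b <= B -> Rabs (a + b) <= A + B.
Proof.
intros Ha Hb. eapply Rle_trans; [apply Rabs_triang|]. lra.
Qed.

Lemma Rabs_minus_le a b A B : Rabs a <= A -> Rabs b <= B -> Rabs (a - b) <= A + B.
Proof.
intros Ha Hb. apply Rabs_plus_le; [|rewrite Rabs_Ropp]; assumption.
Qed.

Lemma increasing_of_pos_derive (f df : R -> R) :
  (forall x, is_derive f x (df x)) -> (forall x, 0 < df x) ->
  forall a b, a < b -> f a < f b.
Proof.
intros Hd Hp a b Hab. destruct (mean_value f df a b) as [c [_ E]]; [auto|].
specialize (Hp c). nra.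
Qed.

(* The linear part of the derivative integrates to zero over the symmetric
   interval. *)
Lemma midpoint_difference (f df : R -> R) z0 h a c e : 0 <= h ->
  (forall z, z0 - h / 2 <= z <= z0 + h / 2 -> is_derive f z (df z)) ->
  (forall z, z0 - h / 2 <= z <= z0 + h / 2 ->
     Rabs (df z - (a + c * (z - z0))) <= e) ->
  Rabs (f (z0 + h / 2) - f (z0 - h / 2) - h * a) <= e * h.
Proof.
intros Hh Hd He.
assert (H := derive_bound_abs (fun z => f z - (a * z + c * (z - z0) ^ 2 / 2))
  (fun z => df z - (a + c * (z - z0))) (z0 - h / 2) (z0 + h / 2) e).
rewrite Rmin_left, Rmax_right in H by lra.
replace (z0 + h / 2 - (z0 - h / 2)) with h in H by lra.
rewrite (Rabs_pos_eq h) in H by lra.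
match type of H with _ -> _ -> Rabs ?t <= _ =>
  replace t with (f (z0 + h / 2) - f (z0 - h / 2) - h * a) in H by field end.
apply H; [|exact He].
intros z Hz. apply (is_derive_minus (V := R_NormedModule)); [auto|].
auto_derive; [auto|]. field.
Qed.

(** A change of sign between the origin and (x, y) would produce a zero on the segment joining
    them. *)
Lemma constant_sign g : (forall x y, continuity_2d_pt g x y) ->
  (forall x y, g x y <> 0) ->
  (forall x y, 0 < g x y) \/ (forall x y, g x y < 0).
Proof.
intros Hc Hn.
assert (H : forall x y, 0 < g 0 0 * g x y).
{ intros x y. destruct (Rlt_dec 0 (g 0 0 * g x y)) as [|Hle]; [assumption|exfalso].
  destruct (IVT_gen (fun s => g (s * x) (s * y)) 0 1 0) as [s [_ Hs]].
  - intros s. apply continuity_pt_filterlim.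
    apply (continuous_comp_2 (fun s => s * x) (fun s => s * y) g).
    + apply (continuous_mult (fun s => s) (fun _ => x)); [apply continuous_id|apply continuous_const].
    + apply (continuous_mult (fun s => s) (fun _ => y)); [apply continuous_id|apply continuous_const].
    + apply (continuity_2d_pt_filterlim g). apply Hc.
  - rewrite !Rmult_0_l, !Rmult_1_l.
    assert (g 0 0 * g x y <= 0) by lra.
    unfold Rmin, Rmax. destruct Rle_dec; split; nra.
  - exact (Hn _ _ Hs). }
destruct (Rlt_dec 0 (g 0 0)) as [Hp|Hp]; [left|right]; intros x y;
  specialize (H x y); pose proof (Hn 0 0); nra.
Qed.

(* At time tn: G1 is the abscissa of the backtracked point, y = p x eta the
   backtracked horizontal line of ordinate eta, and u x eta the abscissa of the
   point of that line which is traced back to abscissa x. *)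
Record cascade_geometry (G1 G1x G1y p px py u : R -> R -> R) : Prop := {
  cg_C2 : Ck2 2 G1;
  cg_xC2 : Ck2 2 G1x;
  cg_dx : forall x y, is_derive (fun z => G1 z y) x (G1x x y);
  cg_dy : forall x y, is_derive (fun z => G1 x z) y (G1y x y);
  cg_pos : forall x y, 0 < G1x x y;
  cg_pC2 : Ck2 2 p;
  cg_pdx : forall x y, is_derive (fun z => p z y) x (px x y);
  cg_pdy : forall x y, is_derive (fun z => p x z) y (py x y);
  cg_inv : forall x y, G1 (u x y) y = x;
  cg_slope : forall x y, py x y * G1x (u x y) y = 1 }.

Lemma inverse_bounded g R0 : (forall x y, continuity_2d_pt g x y) ->
  (forall x y, 0 < g x y) -> exists M, 0 < M /\
  forall x y, Rabs x <= R0 -> Rabs y <= R0 -> / g x y <= M /\ / M <= g x y.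
Proof.
intros Hc Hp.
destruct (box_bounded (fun x y => / g x y) R0) as [M [HM B]].
{ intros x y. apply continuity_2d_pt_inv; [apply Hc|].
  specialize (Hp x y). lra. }
exists (M + 1). split; [lra|]. intros x y Hx Hy. specialize (B x y Hx Hy).
specialize (Hp x y). assert (Hi := Rinv_0_lt_compat _ Hp).
rewrite Rabs_pos_eq in B by lra. split; [lra|].
rewrite <- (Rinv_inv (g x y)). apply Rinv_le_contravar; lra.
Qed.

(** u is known only through the equation G1 (u x y) y = x, so it is trapped by monotonicity: at
    distance M h from x0, the value of G1 in row y has already passed x. *)
Lemma root_displacement G1 G1x G1y p px py u R0 N :
  cascade_geometry G1 G1x G1y p px py u -> 0 <= N ->
  exists M h0, 0 <= M /\ 0 < h0 <= 1 /\ M * h0 <= 1 /\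
  forall x0 y0 h x y, Rabs x0 <= R0 -> Rabs y0 <= R0 -> 0 < h <= h0 ->
  Rabs (x - G1 x0 y0) <= N * h -> Rabs (y - y0) <= h ->
  Rabs (u x y - x0) <= M * h.
Proof.
intros [CG CGx Dx Dy Hpos _ _ _ Hinv _] HN.
destruct (inverse_bounded G1x (R0 + 1) (Ck2_continuity_2d _ _ CGx) Hpos)
  as [K [HK BK]].
destruct (Ck2_lipschitz G1 (R0 + 1) (Ck2_pred _ _ CG)) as [L [HL BL]].
(* Since G1x >= / K, a shift by M h changes G1 by at least (N + L + 1) h, whereas x is at most (N +
   L) h away from G1 x0 y. The bound M h <= 1 keeps the shift in the box. *)
set (M := K * (N + L + 1)).
assert (HM : 0 < M) by (unfold M; nra).
exists M, (Rmin 1 (/ M)).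
assert (HiM := Rinv_0_lt_compat M HM).
split; [lra|]. split; [split; [apply Rmin_glb_lt; lra|apply Rmin_l]|].
split.
{ apply Rle_trans with (M * / M); [apply Rmult_le_compat_l; [lra|apply Rmin_r]|].
  right. field. lra. }
intros x0 y0 h x y Hx0 Hy0 Hh Hx Hy.
assert (Hh1 : h <= 1) by (eapply Rle_trans; [apply Hh|apply Rmin_l]).
assert (HMh : M * h <= 1).
{ apply Rle_trans with (M * / M); [|right; field; lra].
  apply Rmult_le_compat_l; [lra|]. eapply Rle_trans; [apply Hh|apply Rmin_r]. }
apply Rabs_le_between in Hx0, Hy0, Hx. assert (Hy' := Hy).
apply Rabs_le_between in Hy'.
assert (Hbase : Rabs (G1 x0 y - G1 x0 y0) <= L * h).
{ assert (E := BL x0 y0 x0 y ltac:(apply Rabs_le; lra) ltac:(apply Rabs_le; lra)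
    ltac:(apply Rabs_le; lra) ltac:(apply Rabs_le; lra)).
  rewrite Rminus_diag, Rabs_R0 in E by reflexivity. nra. }
apply Rabs_le_between in Hbase.
assert (Hmono : forall a b, a < b -> G1 a y < G1 b y).
{ apply (increasing_of_pos_derive (fun z => G1 z y) (fun z => G1x z y)); auto. }
assert (Hstep : forall s, Rabs s <= M * h -> exists c,
  G1 (x0 + s) y - G1 x0 y = c * s /\ / K <= c).
{ intros s Hs. assert (Hs1 : Rabs s <= 1) by lra. apply Rabs_le_between in Hs1.
  destruct (mean_value (fun z => G1 z y) (fun z => G1x z y) x0 (x0 + s))
    as [c [Hc E]]; [auto|].
  exists (G1x c y). split; [rewrite E; ring|].
  apply BK; [|apply Rabs_le; lra].
  apply (between_box x0 (x0 + s)); [apply Rabs_le; lra|apply Rabs_le; lra|exact Hc]. }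
assert (HKM : / K * M = N + L + 1) by (unfold M; field; lra).
assert (EG := Hinv x y).
apply Rabs_le. split.
- destruct (Rle_dec (- (M * h)) (u x y - x0)) as [|Hlt]; [assumption|exfalso].
  assert (Hm := Hmono (u x y) (x0 + - (M * h)) ltac:(lra)).
  destruct (Hstep (- (M * h))) as [c [Ec Hc]].
  { rewrite Rabs_Ropp, Rabs_pos_eq; nra. }
  assert (c * (M * h) >= (N + L + 1) * h).
  { rewrite <- HKM. assert (0 <= M * h) by nra. nra. }
  lra.
- destruct (Rle_dec (u x y - x0) (M * h)) as [|Hlt]; [assumption|exfalso].
  assert (Hm := Hmono (x0 + M * h) (u x y) ltac:(lra)).
  destruct (Hstep (M * h)) as [c [Ec Hc]].
  { rewrite Rabs_pos_eq; nra. }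
  assert (c * (M * h) >= (N + L + 1) * h).
  { rewrite <- HKM. assert (0 <= M * h) by nra. nra. }
  lra.
Qed.

(* p is only C^2, but its slope 1 / G1x(u, y) inherits a second order Taylor
   expansion from the C^2 function G1x. *)
Lemma slope_expansion G1 G1x G1y p px py u R0 N :
  cascade_geometry G1 G1x G1y p px py u -> 0 <= N ->
  exists M h0, 0 <= M /\ 0 < h0 <= 1 /\
  forall x0 y0, Rabs x0 <= R0 -> Rabs y0 <= R0 ->
  exists b c, Rabs b <= M /\ forall h x y, 0 < h <= h0 ->
  Rabs (x - G1 x0 y0) <= N * h -> Rabs (y - y0) <= h ->
  Rabs (py x y - (/ G1x x0 y0 + b * (x - G1 x0 y0) + c * (y - y0))) <= M * h ^ 2.
Proof.
intros CG HN.
destruct (root_displacement _ _ _ _ _ _ _ R0 N CG HN) as (Mu & h0 & HMu & Hh0 & HMh & Hu).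
destruct CG as [CG CGx Dx Dy Hpos _ _ _ Hinv Hsl].
destruct (Ck2_derivatives _ _ CGx) as (Gxx & Gxy & Dxx & Dxy & CGxx & CGxy).
destruct (inverse_bounded G1x (R0 + 1) (Ck2_continuity_2d _ _ CGx) Hpos)
  as [K [HK BK]].
destruct (Ck2_taylor G1 G1x G1y (R0 + 1) CG Dx Dy) as [M1 [HM1 T1]].
destruct (Ck2_taylor G1x Gxx Gxy (R0 + 1) CGx Dxx Dxy) as [M2 [HM2 T2]].
destruct (Ck2_lipschitz G1x (R0 + 1) (Ck2_pred _ _ CGx)) as [L [HL BL]].
(* The point (u x y, y) is within q h of (x0, y0): Mu h from the root, h from the ordinate. *)
set (q := Mu + 1).
set (E := M2 * q * (L * q) * (K * K * K) + M2 * q ^ 2 * (K * K)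
          + M2 * (M1 * q ^ 2) * (K * K * K)).
exists (E + M2 * (K * K * K)), h0.
assert (0 <= q) by (unfold q; lra).
assert (HE : 0 <= E).
{ unfold E. repeat (apply Rplus_le_le_0_compat || apply Rmult_le_pos ||
   apply pow_le); lra. }
assert (HK3 : 0 <= M2 * (K * K * K)) by (repeat apply Rmult_le_pos; lra).
split; [lra|]. split; [exact Hh0|].
intros x0 y0 Hx0 Hy0.
set (D0 := G1x x0 y0). set (D1 := Gxx x0 y0). set (D2 := Gxy x0 y0).
set (E2 := G1y x0 y0).
assert (Hbox : forall z z0 r, Rabs z0 <= R0 -> Rabs (z - z0) <= r -> r <= 1 -> Rabs z <= R0 + 1).
{ intros z z0 r A1 A2 A3. replace z with (z0 + (z - z0)) by ring.
  apply Rabs_plus_le; lra. }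
assert (Hx0' : Rabs x0 <= R0 + 1) by lra. assert (Hy0' : Rabs y0 <= R0 + 1) by lra.
assert (HD0 : 0 < D0) by apply Hpos.
assert (BD0 : Rabs (/ D0) <= K).
{ rewrite Rabs_pos_eq by (left; apply Rinv_0_lt_compat, HD0). apply BK; assumption. }
destruct (T2 x0 y0 x0 y0 Hx0' Hy0' Hx0' Hy0') as (BD1 & BD2 & _).
fold D1 in BD1. fold D2 in BD2.
(* Formal partial derivatives of 1 / G1x (u x y) y, with u_x = 1 / D0 and u_y = - E2 / D0 from
   implicit differentiation. *)
exists (- D1 * (/ D0 * / D0 * / D0)), (- (D2 - D1 * E2 * / D0) * (/ D0 * / D0)).
split.
{ apply Rle_trans with (M2 * (K * K * K)); [|lra].
  repeat apply Rabs_mult_le; auto. rewrite Rabs_Ropp. exact BD1. }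
intros h x y Hh Hx Hy.
assert (Hdu := Hu x0 y0 h x y Hx0 Hy0 Hh Hx Hy).
assert (HMuh : Mu * h <= 1) by nra.
set (z := u x y) in *.
assert (Hz : Rabs z <= R0 + 1) by (apply (Hbox z x0 (Mu * h)); auto).
assert (Hyb : Rabs y <= R0 + 1) by (apply (Hbox y y0 h); auto; lra).
destruct (T1 x0 y0 z y Hx0' Hy0' Hz Hyb) as (_ & _ & A1).
destruct (T2 x0 y0 z y Hx0' Hy0' Hz Hyb) as (_ & _ & A2).
assert (A3 := BL x0 y0 z y Hx0' Hy0' Hz Hyb).
set (D := G1x z y) in *. fold D0 in A1, A2, A3.
fold E2 in A1. fold D1 D2 in A2.
assert (HD : 0 < D) by apply Hpos.
assert (BD : Rabs (/ D) <= K).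
{ rewrite Rabs_pos_eq by (left; apply Rinv_0_lt_compat, HD). apply BK; assumption. }
assert (Epy : py x y = / D).
{ apply (Rmult_eq_reg_r D); [|lra]. rewrite Rinv_l by lra. apply Hsl. }
assert (EG : G1 z y = x) by apply Hinv.
rewrite EG in A1.
set (s := Rabs (z - x0) + Rabs (y - y0)) in *.
assert (Hs : 0 <= s <= q * h).
{ unfold s, q. pose proof (Rabs_pos (z - x0)). pose proof (Rabs_pos (y - y0)). lra. }
assert (Hs2 : s ^ 2 <= (q * h) ^ 2) by (apply pow_incr; exact Hs).
set (xc := G1 x0 y0) in *.
set (r1 := x - (xc + D0 * (z - x0) + E2 * (y - y0))) in *.
set (dlt := D1 * (z - x0) + D2 * (y - y0)).
set (r2 := D - (D0 + D1 * (z - x0) + D2 * (y - y0))) in *.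
assert (Bdlt : Rabs dlt <= M2 * (q * h)).
{ unfold dlt. apply Rle_trans with (M2 * Rabs (z - x0) + M2 * Rabs (y - y0)).
  - apply Rabs_plus_le; apply Rabs_mult_le; auto; lra.
  - rewrite <- Rmult_plus_distr_l. apply Rmult_le_compat_l; [lra|]. apply Hs. }
assert (BL' : Rabs (D - D0) <= L * (q * h)).
{ eapply Rle_trans; [exact A3|]. apply Rmult_le_compat_l; lra. }
assert (B1 : Rabs r1 <= M1 * (q * h) ^ 2).
{ eapply Rle_trans; [exact A1|]. apply Rmult_le_compat_l; lra. }
assert (B2 : Rabs r2 <= M2 * (q * h) ^ 2).
{ eapply Rle_trans; [exact A2|]. apply Rmult_le_compat_l; lra. }
rewrite Epy.
(* The three errors are the quadratic term in the expansion of 1 / D, the Taylor remainder of G1x,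
   and the remainder of G1 incurred when z - x0 is expressed through x and y. They match the
   summands of E. *)
match goal with |- Rabs ?t <= _ => replace t with
  (dlt * (D - D0) * (/ D0 * / D0 * / D) - r2 * (/ D * / D0)
   + D1 * r1 * (/ D0 * / D0 * / D0)) by (unfold dlt, r1, r2; field; lra) end.
apply Rle_trans with (E * h ^ 2).
- apply Rle_trans with (M2 * (q * h) * (L * (q * h)) * (K * K * K)
    + M2 * (q * h) ^ 2 * (K * K) + M2 * (M1 * (q * h) ^ 2) * (K * K * K)).
  + apply Rabs_plus_le; [apply Rabs_minus_le|]; repeat apply Rabs_mult_le; auto.
  + right. unfold E. ring.
- apply Rmult_le_compat_r; [apply pow2_ge_0|]. lra.
Qed.

Lemma slope_pos G1 G1x G1y p px py u :
  cascade_geometry G1 G1x G1y p px py u -> forall x y, 0 < py x y.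
Proof.
intros CG x y. pose proof (cg_slope _ _ _ _ _ _ _ CG x y).
pose proof (cg_pos _ _ _ _ _ _ _ CG (u x y) y). nra.
Qed.

(** * The two sweeps *)

Lemma Rabs_near x c r e B : Rabs c <= B -> Rabs (x - c) <= r -> B + r <= e -> Rabs x <= e.
Proof.
intros Hc Hx He. replace x with (c + (x - c)) by ring.
eapply Rle_trans; [apply Rabs_plus_le; eassumption|exact He].
Qed.

(** A stencil of the second sweep spans several columns and needs one affine model for all of them;
    hence B is chosen before i. *)
Lemma column_mass d g G1 G1x G1y p px py u R0 N :
  (1 <= d)%nat -> Ck2 2 g -> cascade_geometry G1 G1x G1y p px py u -> 0 <= N ->
  exists C h0, 0 <= C /\ 0 < h0 <= 1 /\
  forall xmin ymin h l x0, 0 < h <= h0 ->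
  let y0 := face ymin h l + h / 2 in
  let xc := G1 x0 y0 in
  Rabs x0 <= R0 -> Rabs y0 <= R0 ->
  forall fbar : Z -> Z -> R,
  (forall i j, fbar i j = cell_average xmin ymin h g i j) ->
  exists B, Rabs B <= C /\ forall i,
  Rabs (face xmin h i + h / 2 - xc) <= N * h ->
  Rabs (mass_I d xmin ymin h p fbar i l / h
        - h * (g xc (p xc y0) * / G1x x0 y0 + B * (face xmin h i + h / 2 - xc)))
  <= C * h ^ 3.
Proof.
intros Hd Hg CG HN.
assert (Hpy := slope_pos _ _ _ _ _ _ _ CG).
(* N + 1 and not N: the slope is needed on the vertical sides of a column, half a cell from its
   centre. *)
destruct (slope_expansion _ _ _ _ _ _ _ R0 (N + 1) CG ltac:(lra))
  as (Ms & h0 & HMs & Hh0 & Hsl).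
destruct CG as [CG CGx Dx Dy Hpos Cp Dpx Dpy _ _].
destruct (Ck2_derivatives _ _ Hg) as (gx & gy & Dgx & Dgy & _ & _).
destruct (box_bounded G1 R0 (Ck2_continuity_2d _ _ CG)) as [BG [HBG BGb]].
destruct (inverse_bounded G1x R0 (Ck2_continuity_2d _ _ CGx) Hpos) as [K [HK BK]].
set (RA := BG + (N + 1) + R0 + 1).
destruct (box_bounded p RA (Ck2_continuity_2d _ _ Cp)) as [Bp [HBp Bpb]].
destruct (Ck2_lipschitz p RA (Ck2_pred _ _ Cp)) as [Lp [HLp BLp]].
destruct (Ck2_taylor p px py RA Cp Dpx Dpy) as [Mp [HMp Tp]].
destruct (remap_estimate d Lp Hd HLp) as [Cr [HCr Hremap]].
(* Reach of the first sweep from yc, in cells: that of [remap_estimate] around a displaced face,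
   plus the distance of this face from yc. *)
set (Q := Lp + INR d + 3 + Lp * (N + 1)).
assert (Hdp := pos_INR d).
assert (HQ : 0 <= Q) by (unfold Q; nra).
set (RB := RA + Bp + Q).
destruct (box_bounded g RB (Ck2_continuity_2d _ _ Hg)) as [Bg [HBg Bgb]].
destruct (Ck2_taylor g gx gy RB Hg Dgx Dgy) as [Mg [HMg Tg]].
destruct (cell_average_center g RB Hg) as [Mc [HMc Tc]].
set (Ce := Mc + Mg * (N + Q) ^ 2).
set (CB := Ms * Bg + (Mg + Mg * Mp) * K).
set (Cs := Mp * (N + 1) ^ 2).
(* One summand for each error in the final decomposition: reconstruction, product of slopes, width,
   midpoint. *)
set (C := Cr * Ce + Ms * ((Mg + Mg * Mp) * N ^ 2)
   + Ms * (Bg + (Mg + Mg * Mp) * N + Mg * Cs) + (K + Ms * N) * (Mg * Cs)).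
assert (HCe : 0 <= Ce) by (apply Rplus_le_le_0_compat; [lra|]; apply Rmult_le_pos; [lra|apply pow2_ge_0]).
assert (HCs : 0 <= Cs) by (apply Rmult_le_pos; [lra|apply pow2_ge_0]).
assert (HMM : 0 <= Mg + Mg * Mp) by nra.
assert (HCB : 0 <= CB).
{ unfold CB. apply Rplus_le_le_0_compat; apply Rmult_le_pos; lra. }
assert (HC : 0 <= C).
{ unfold C. repeat (apply Rplus_le_le_0_compat || apply Rmult_le_pos || apply pow_le); lra. }
exists (CB + C), h0. split; [lra|]. split; [exact Hh0|].
intros xmin ymin h l x0 Hh y0 xc Hx0 Hy0 fbar Hfb.
assert (HR0 : 0 <= R0) by (pose proof (Rabs_pos x0); lra).
destruct (Hsl x0 y0 Hx0 Hy0) as (b & c & Hb & Hslope). clear Hsl.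
set (yc := p xc y0) in *. fold xc in Hslope.
set (D0 := G1x x0 y0) in *.
assert (HD0p : 0 < D0) by apply Hpos.
assert (HD0 : Rabs (/ D0) <= K).
{ rewrite Rabs_pos_eq by (left; apply Rinv_0_lt_compat, Hpos). apply BK; assumption. }
assert (Hxc : Rabs xc <= BG) by (apply BGb; assumption).
assert (Hyc : Rabs yc <= Bp).
{ apply Bpb; unfold RA; lra. }
assert (HxcRA : Rabs xc <= RA) by (unfold RA; lra).
assert (Hy0RA : Rabs y0 <= RA) by (unfold RA; lra).
assert (HxcRB : Rabs xc <= RB) by (unfold RB; lra).
assert (HycRB : Rabs yc <= RB) by (unfold RB, RA; lra).
destruct (Tg xc yc xc yc) as (Bgx & Bgy & _); auto.
destruct (Tp xc y0 xc y0) as (Bpx & _ & _); auto.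
set (gc := g xc yc) in *. set (g1 := gx xc yc) in *. set (g2 := gy xc yc) in *.
set (p1 := px xc y0) in *.
assert (Hgc : Rabs gc <= Bg) by (apply Bgb; assumption).
assert (Hg12 : Rabs (g1 + g2 * p1) <= Mg + Mg * Mp).
{ apply Rabs_plus_le; [assumption|apply Rabs_mult_le; assumption]. }
(* The product rule for width times density: b is the slope of the width, g1 + g2 * p1 that of g
   along the backtracked line. *)
exists (b * gc + (g1 + g2 * p1) * / D0). split.
{ apply Rle_trans with CB; [|lra].
  apply Rabs_plus_le; apply Rabs_mult_le; assumption. }
intros i Hi.
set (dx := face xmin h i + h / 2 - xc) in *.
set (ym := face ymin h l) in *.
assert (Eyp : face ymin h (l + 1) = ym + h) by apply face_succ.
assert (Ey0 : y0 = ym + h / 2) by reflexivity.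
assert (Hxf : forall xf, xf = face xmin h i \/ xf = face xmin h i + h ->
  Rabs (xf - xc) <= (N + / 2) * h).
{ intros xf Hxf. apply Rabs_le_between in Hi.
  apply Rabs_le. unfold dx in Hi. destruct Hxf as [-> | ->]; lra. }
assert (Hxf' : forall xf, xf = face xmin h i \/ xf = face xmin h i + h -> Rabs xf <= RA).
{ intros xf H. apply (Rabs_near xf xc ((N + / 2) * h) _ BG); auto. unfold RA. nra. }
assert (Hyf : forall yf, yf = ym \/ yf = ym + h -> Rabs (yf - y0) <= / 2 * h).
{ intros yf Hyf. apply Rabs_le. destruct Hyf as [-> | ->]; lra. }
assert (Hyf' : forall yf, yf = ym \/ yf = ym + h -> Rabs yf <= RA).
{ intros yf H. apply (Rabs_near yf y0 (/ 2 * h) _ R0); auto. unfold RA. lra. }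
set (xs := fun j => ybar xmin ymin h p i j).
set (xa := face xmin h i) in *.
assert (Es0 : xs l = / 2 * (p xa ym + p (xa + h) ym)).
{ unfold xs, ybar. rewrite face_succ. reflexivity. }
assert (Es1 : xs (l + 1)%Z = / 2 * (p xa (ym + h) + p (xa + h) (ym + h))).
{ unfold xs, ybar. rewrite !face_succ. reflexivity. }
assert (Hcorner : forall xf yf, xf = xa \/ xf = xa + h -> yf = ym \/ yf = ym + h ->
  Rabs (p xf yf - (yc + p1 * (xf - xc) + py xc y0 * (yf - y0))) <= Cs * h ^ 2
  /\ Rabs (p xf yf - yc) <= Lp * (N + 1) * h).
{ intros xf yf Hf1 Hf2.
  assert (Rabs (xf - xc) + Rabs (yf - y0) <= (N + 1) * h).
  { specialize (Hxf xf Hf1). specialize (Hyf yf Hf2). lra. }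
  split.
  - destruct (Tp xc y0 xf yf) as (_ & _ & T); auto.
    eapply Rle_trans; [exact T|]. unfold Cs.
    replace (Mp * (N + 1) ^ 2 * h ^ 2) with (Mp * ((N + 1) * h) ^ 2) by ring.
    apply Rmult_le_compat_l; [exact HMp|]. apply pow_incr. split; [|assumption].
    apply Rplus_le_le_0_compat; apply Rabs_pos.
  - eapply Rle_trans; [apply BLp; auto|]. rewrite Rmult_assoc.
    apply Rmult_le_compat_l; assumption. }
assert (Hwidth : forall xf, xf = xa \/ xf = xa + h ->
  Rabs (p xf (ym + h) - p xf ym - h * (/ D0 + b * (xf - xc))) <= Ms * h ^ 2 * h
  /\ 0 <= p xf (ym + h) - p xf ym <= Lp * h).
{ intros xf Hf. split; [|split].
  - replace (ym + h) with (y0 + h / 2) by (rewrite Ey0; field).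
    replace ym with (y0 - h / 2) by (rewrite Ey0; field).
    apply (midpoint_difference (fun z => p xf z) (fun z => py xf z) y0 h _ c); [lra|auto|].
    intros z Hz. apply Hslope; [exact Hh| |].
    + specialize (Hxf xf Hf). lra.
    + apply Rabs_le. lra.
  - assert (H := increasing_of_pos_derive (fun z => p xf z) (fun z => py xf z)
      ltac:(auto) ltac:(auto) ym (ym + h) ltac:(lra)). cbv beta in H. lra.
  - assert (H := BLp xf ym xf (ym + h) ltac:(auto) ltac:(auto) ltac:(auto) ltac:(auto)).
    rewrite (Rminus_diag xf), Rabs_R0 in H by reflexivity.
    replace (ym + h - ym) with h in H by ring.
    rewrite (Rabs_pos_eq h), Rplus_0_l in H by lra.
    apply Rabs_le_between in H. lra. }
destruct (Hwidth xa (or_introl eq_refl)) as [W1 V1].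
destruct (Hwidth (xa + h) (or_intror eq_refl)) as [W2 V2].
destruct (Hcorner xa ym ltac:(auto) ltac:(auto)) as [C1 L1].
destruct (Hcorner (xa + h) ym ltac:(auto) ltac:(auto)) as [C2 L2].
destruct (Hcorner xa (ym + h) ltac:(auto) ltac:(auto)) as [C3 _].
destruct (Hcorner (xa + h) (ym + h) ltac:(auto) ltac:(auto)) as [C4 _].
assert (Hdx1 : Rabs dx <= N) by nra.
assert (Hm : Rabs (mass_I d xmin ymin h p fbar i l
   - (xs (l + 1)%Z - xs l) * (h * (gc + g1 * dx)
        + h * g2 * ((xs l + xs (l + 1)%Z) / 2 - yc))) <= Cr * (h * (h * (Ce * h ^ 2)))).
{ unfold mass_I. fold xs.
  apply (Hremap ymin h xs (fun j' => h * fbar i j') l); [lra| | |].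
  - apply Rmult_le_pos; [lra|]. apply Rmult_le_pos; [lra|]. apply pow2_ge_0.
  - rewrite Es0, Es1. lra.
  - intros j Hj. set (yj := face ymin h j + h / 2) in *.
    assert (Hyj : Rabs (yj - yc) <= Q * h).
    { replace (yj - yc) with ((yj - xs l) + (xs l - yc)) by ring.
      replace (Q * h) with ((Lp + INR d + 3) * h + Lp * (N + 1) * h) by (unfold Q; ring).
      apply Rabs_plus_le; [exact Hj|]. rewrite Es0.
      apply Rabs_le_between in L1, L2. apply Rabs_le. lra. }
    assert (HyjB : Rabs yj <= RB).
    { apply (Rabs_near yj yc (Q * h) _ Bp); auto. unfold RB, RA. nra. }
    assert (HxiB : Rabs (xa + h / 2) <= RB).
    { apply (Rabs_near _ xc (N * h) _ BG); auto. unfold RB, RA. nra. }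
    replace (h * fbar i j - (h * (gc + g1 * dx) + h * g2 * (yj - yc)))
      with (h * ((fbar i j - g (xa + h / 2) yj)
                 + (g (xa + h / 2) yj - (gc + g1 * dx + g2 * (yj - yc))))) by ring.
    rewrite Rabs_mult, (Rabs_pos_eq h) by lra.
    apply Rmult_le_compat_l; [lra|].
    replace (Ce * h ^ 2) with (Mc * h ^ 2 + Mg * ((N + Q) * h) ^ 2) by (unfold Ce; ring).
    apply Rabs_plus_le.
    + rewrite Hfb. apply Tc; [lra|exact HxiB|exact HyjB].
    + destruct (Tg xc yc (xa + h / 2) yj) as (_ & _ & T); auto.
      eapply Rle_trans; [exact T|]. apply Rmult_le_compat_l; [exact HMg|].
      apply pow_incr. split; [apply Rplus_le_le_0_compat; apply Rabs_pos|].
      fold dx. lra. }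
set (w := xs (l + 1)%Z - xs l) in *. set (s := (xs l + xs (l + 1)%Z) / 2) in *.
set (rw := w - h * (/ D0 + b * dx)).
set (rs := s - yc - p1 * dx).
(* w is the mean of the widths on the two sides of the column, whose abscissas average to the
   centre; the slope term becomes b * dx. *)
assert (Brw : Rabs rw <= Ms * h ^ 3).
{ apply Rabs_le_between in W1, W2. apply Rabs_le. unfold rw, w. rewrite Es0, Es1.
  unfold dx. fold xa. lra. }
assert (Brs : Rabs rs <= Cs * h ^ 2).
(* The lower and upper corners are symmetric about y0, so the terms in py cancel in the mean. *)
{ assert (Epy : py xc y0 * (ym - y0) = - (py xc y0 * (ym + h - y0))).
  { replace (ym - y0) with (- (ym + h - y0)) by lra. ring. }
  apply Rabs_le_between in C1, C2, C3, C4. apply Rabs_le. unfold rs, s. rewrite Es0, Es1.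
  unfold dx. lra. }
assert (Brs1 : Rabs rs <= Cs).
{ eapply Rle_trans; [exact Brs|]. assert (h ^ 2 <= 1) by nra. nra. }
set (mI := mass_I d xmin ymin h p fbar i l) in *.
(* Width times density is expanded to first order in dx; the product of the two slopes is already
   O(h^3) with the factor h. *)
replace (mI / h - h * (gc * / D0 + (b * gc + (g1 + g2 * p1) * / D0) * dx)) with
  ((mI - w * (h * (gc + g1 * dx) + h * g2 * (s - yc))) / h
   + h * (b * ((g1 + g2 * p1) * (dx * dx)))
   + rw * (gc + (g1 + g2 * p1) * dx + g2 * rs)
   + h * ((/ D0 + b * dx) * (g2 * rs)))
  by (unfold rw, rs; field; split; lra).
apply Rle_trans with (C * h ^ 3);
  [|apply Rmult_le_compat_r; [apply pow_le|]; lra].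
apply Rle_trans with (Cr * (h * (h * (Ce * h ^ 2))) * / h
  + h * (Ms * ((Mg + Mg * Mp) * ((N * h) * (N * h))))
  + Ms * h ^ 3 * (Bg + (Mg + Mg * Mp) * N + Mg * Cs)
  + h * ((K + Ms * N) * (Mg * (Cs * h ^ 2)))).
- assert (Hhh : Rabs h <= h) by (rewrite Rabs_pos_eq; lra).
  assert (Hih : Rabs (/ h) <= / h).
  { rewrite Rabs_pos_eq; [lra|]. left. apply Rinv_0_lt_compat. lra. }
  repeat first [assumption | apply Rabs_mult_le | apply Rabs_plus_le].
- right. unfold C. field. lra.
Qed.

Lemma cascade_mass d g G1 G1x G1y p px py u R0 :
  (1 <= d)%nat -> Ck2 2 g -> cascade_geometry G1 G1x G1y p px py u ->
  exists C h0, 0 <= C /\ 0 < h0 <= 1 /\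
  forall xmin ymin h k l, 0 < h <= h0 ->
  let x0 := face xmin h k + h / 2 in
  let y0 := face ymin h l + h / 2 in
  let xc := G1 x0 y0 in
  Rabs x0 <= R0 -> Rabs y0 <= R0 ->
  forall fbar : Z -> Z -> R,
  (forall i j, fbar i j = cell_average xmin ymin h g i j) ->
  Rabs (mass_B d xmin ymin h G1 p fbar k l - h ^ 2 * g xc (p xc y0)) <= C * h ^ 4.
Proof.
intros Hd Hg CG.
destruct (Ck2_lipschitz G1 (R0 + 1) (Ck2_pred _ _ (cg_C2 _ _ _ _ _ _ _ CG)))
  as [L [HL BL]].
assert (Hdp := pos_INR d).
(* The stencil reaches L + d + 3 cells from the displaced face, which itself lies within L cells of
   xc. *)
set (N := 2 * L + INR d + 3).
assert (HN : 0 <= N) by (unfold N; lra).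
destruct (column_mass d g _ _ _ _ _ _ _ R0 N Hd Hg CG HN)
  as (CI & h0 & HCI & Hh0 & HI).
destruct CG as [CG CGx Dx Dy Hpos Cp _ _ _ _].
destruct (box_bounded G1 R0 (Ck2_continuity_2d _ _ CG)) as [BG [HBG BGb]].
destruct (inverse_bounded G1x R0 (Ck2_continuity_2d _ _ CGx) Hpos) as [K [HK BK]].
destruct (box_bounded p (BG + R0) (Ck2_continuity_2d _ _ Cp)) as [Bp [HBp Bpb]].
destruct (box_bounded g (BG + Bp) (Ck2_continuity_2d _ _ Hg)) as [Bg [HBg Bgb]].
destruct (Ck2_derivatives _ _ CGx) as (Gxx & Gxy & Dxx & Dxy & _ & _).
destruct (Ck2_taylor G1 G1x G1y (R0 + 1) CG Dx Dy) as [M1 [HM1 T1]].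
destruct (Ck2_taylor G1x Gxx Gxy (R0 + 1) CGx Dxx Dxy) as [M2 [HM2 T2]].
destruct (remap_estimate d L Hd HL) as [Cr [HCr Hremap]].
set (C := Cr * CI + M2 * (Bg * K) + L * (CI * M1)).
exists C, h0. split.
{ unfold C. repeat (apply Rplus_le_le_0_compat || apply Rmult_le_pos); lra. }
split; [exact Hh0|].
intros xmin ymin h k l Hh x0 y0 xc Hx0 Hy0 fbar Hfb.
assert (HR0 : 0 <= R0) by (pose proof (Rabs_pos x0); lra).
destruct (HI xmin ymin h l x0 Hh Hx0 Hy0 fbar Hfb) as (B & HB & HIi). clear HI.
fold y0 in HIi. fold xc in HIi.
set (yc := p xc y0) in *. set (gc := g xc yc) in *. set (D0 := G1x x0 y0) in *.
assert (HD0p : 0 < D0) by apply Hpos.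
assert (HD0 : Rabs (/ D0) <= K).
{ rewrite Rabs_pos_eq by (left; apply Rinv_0_lt_compat, HD0p). apply BK; assumption. }
assert (Hxc : Rabs xc <= BG) by (apply BGb; assumption).
assert (Hyc : Rabs yc <= Bp) by (apply Bpb; lra).
assert (Hgc : Rabs gc <= Bg) by (apply Bgb; lra).
set (xm := face xmin h k) in *. set (ym := face ymin h l) in *.
assert (Ex0 : x0 = xm + h / 2) by reflexivity.
assert (Ey0 : y0 = ym + h / 2) by reflexivity.
assert (Hxf : forall xf, xf = xm \/ xf = xm + h ->
  Rabs (xf - x0) <= h / 2 /\ Rabs xf <= R0 + 1).
{ intros xf H. assert (E : Rabs (xf - x0) <= h / 2).
  { apply Rabs_le. destruct H as [-> | ->]; lra. }
  split; [exact E|]. apply (Rabs_near xf x0 (h / 2) _ R0); auto. lra. }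
assert (Hyf : forall yf, yf = ym \/ yf = ym + h ->
  Rabs (yf - y0) <= h / 2 /\ Rabs yf <= R0 + 1).
{ intros yf H. assert (E : Rabs (yf - y0) <= h / 2).
  { apply Rabs_le. destruct H as [-> | ->]; lra. }
  split; [exact E|]. apply (Rabs_near yf y0 (h / 2) _ R0); auto. lra. }
assert (Hx0' : Rabs x0 <= R0 + 1) by lra. assert (Hy0' : Rabs y0 <= R0 + 1) by lra.
assert (Hcorner : forall xf yf, xf = xm \/ xf = xm + h -> yf = ym \/ yf = ym + h ->
  Rabs (G1 xf yf - (xc + D0 * (xf - x0) + G1y x0 y0 * (yf - y0))) <= M1 * h ^ 2
  /\ Rabs (G1 xf yf - xc) <= L * h).
{ intros xf yf H1 H2. destruct (Hxf xf H1) as [A1 A2]. destruct (Hyf yf H2) as [A3 A4].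
  split.
  - destruct (T1 x0 y0 xf yf) as (_ & _ & T); auto.
    eapply Rle_trans; [exact T|]. apply Rmult_le_compat_l; [exact HM1|].
    apply pow_incr. split; [apply Rplus_le_le_0_compat; apply Rabs_pos|]. lra.
  - eapply Rle_trans; [apply BL; auto|]. apply Rmult_le_compat_l; lra. }
assert (Hwidth : forall yf, yf = ym \/ yf = ym + h ->
  Rabs (G1 (xm + h) yf - G1 xm yf - h * (D0 + Gxy x0 y0 * (yf - y0))) <= M2 * h ^ 2 * h
  /\ 0 <= G1 (xm + h) yf - G1 xm yf <= L * h).
{ intros yf H. destruct (Hyf yf H) as [A3 A4]. split; [|split].
  - replace (xm + h) with (x0 + h / 2) by (rewrite Ex0; field).
    replace xm with (x0 - h / 2) by (rewrite Ex0; field).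
    apply (midpoint_difference (fun z => G1 z yf) (fun z => G1x z yf) x0 h _ (Gxx x0 y0));
      [lra|auto|].
    intros z Hz. assert (Hzx : Rabs (z - x0) <= h / 2) by (apply Rabs_le; lra).
    destruct (T2 x0 y0 z yf) as (_ & _ & T); auto.
    { apply (Rabs_near z x0 (h / 2) _ R0); auto. lra. }
    replace (D0 + Gxy x0 y0 * (yf - y0) + Gxx x0 y0 * (z - x0))
      with (D0 + Gxx x0 y0 * (z - x0) + Gxy x0 y0 * (yf - y0)) by ring.
    eapply Rle_trans; [exact T|]. apply Rmult_le_compat_l; [exact HM2|].
    apply pow_incr. split; [apply Rplus_le_le_0_compat; apply Rabs_pos|]. lra.
  - assert (Hm := increasing_of_pos_derive (fun z => G1 z yf) (fun z => G1x z yf)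
      (fun z => Dx z yf) (fun z => Hpos z yf) xm (xm + h) ltac:(lra)). cbv beta in Hm. lra.
  - destruct (Hxf xm) as [_ A1]; auto. destruct (Hxf (xm + h)) as [_ A2]; auto.
    assert (Hm := BL xm yf (xm + h) yf A1 A4 A2 A4).
    rewrite (Rminus_diag yf), Rabs_R0 in Hm by reflexivity.
    replace (xm + h - xm) with h in Hm by ring.
    rewrite (Rabs_pos_eq h), Rplus_0_r in Hm by lra.
    apply Rabs_le_between in Hm. lra. }
set (xs := fun i => xbar xmin ymin h G1 i l).
assert (Es0 : xs k = / 2 * (G1 xm ym + G1 xm (ym + h))).
{ unfold xs, xbar. rewrite !face_succ. reflexivity. }
assert (Es1 : xs (k + 1)%Z = / 2 * (G1 (xm + h) ym + G1 (xm + h) (ym + h))).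
{ unfold xs, xbar. rewrite !face_succ. reflexivity. }
destruct (Hwidth ym (or_introl eq_refl)) as [W1 V1].
destruct (Hwidth (ym + h) (or_intror eq_refl)) as [W2 V2].
destruct (Hcorner xm ym ltac:(auto) ltac:(auto)) as [C1 L1].
destruct (Hcorner (xm + h) ym ltac:(auto) ltac:(auto)) as [C2 _].
destruct (Hcorner xm (ym + h) ltac:(auto) ltac:(auto)) as [C3 L3].
destruct (Hcorner (xm + h) (ym + h) ltac:(auto) ltac:(auto)) as [C4 _].
assert (Hm : Rabs (mass_B d xmin ymin h G1 p fbar k l
   - (xs (k + 1)%Z - xs k) * (h * (gc * / D0)
        + h * B * ((xs k + xs (k + 1)%Z) / 2 - xc))) <= Cr * (h * (CI * h ^ 3))).
{ unfold mass_B. fold xs.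
  apply (Hremap xmin h xs (fun i => mass_I d xmin ymin h p fbar i l / h) k); [lra| | |].
  - apply Rmult_le_pos; [lra|]. apply pow_le. lra.
  - rewrite Es0, Es1. lra.
  - intros i Hi.
    replace (h * (gc * / D0) + h * B * (face xmin h i + h / 2 - xc))
      with (h * (gc * / D0 + B * (face xmin h i + h / 2 - xc))) by ring.
    apply HIi.
    replace (face xmin h i + h / 2 - xc)
      with ((face xmin h i + h / 2 - xs k) + (xs k - xc)) by ring.
    replace (N * h) with ((L + INR d + 3) * h + L * h) by (unfold N; ring).
    apply Rabs_plus_le; [exact Hi|]. rewrite Es0.
    apply Rabs_le_between in L1, L3. apply Rabs_le. lra. }
set (v := xs (k + 1)%Z - xs k) in *. set (m := (xs k + xs (k + 1)%Z) / 2) in *.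
assert (Ey : ym - y0 = - (ym + h - y0)) by lra.
assert (Ex : xm - x0 = - (xm + h - x0)) by lra.
(* Averaging the widths of the lower and upper edges cancels the mixed derivative Gxy. *)
assert (Bv : Rabs (v - h * D0) <= M2 * h ^ 3).
{ rewrite Ey in W1. apply Rabs_le_between in W1, W2. apply Rabs_le.
  unfold v. rewrite Es0, Es1. lra. }
(* m is the mean over four corners symmetric about (x0, y0), so both linear terms of G1 cancel. *)
assert (Bm : Rabs (m - xc) <= M1 * h ^ 2).
{ rewrite Ey in C1, C2. rewrite Ex in C1, C3.
  apply Rabs_le_between in C1, C2, C3, C4. apply Rabs_le.
  unfold m. rewrite Es0, Es1. lra. }
assert (Bv1 : Rabs v <= L * h).
{ apply Rabs_le. unfold v. rewrite Es0, Es1. lra. }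
set (mB := mass_B d xmin ymin h G1 p fbar k l) in *.
(* The factor / D0 left by the first sweep cancels the stretching D0 of the second, and B multiplies
   only m - xc. *)
replace (mB - h ^ 2 * gc) with
  ((mB - v * (h * (gc * / D0) + h * B * (m - xc)))
   + (v - h * D0) * (h * (gc * / D0)) + v * (h * (B * (m - xc)))) by (field; lra).
apply Rle_trans with (Cr * (h * (CI * h ^ 3)) + M2 * h ^ 3 * (h * (Bg * K))
   + L * h * (h * (CI * (M1 * h ^ 2)))).
- assert (Hhh : Rabs h <= h) by (rewrite Rabs_pos_eq; lra).
  repeat first [assumption | apply Rabs_mult_le | apply Rabs_plus_le].
- right. unfold C. ring.
Qed.

(** * Area preservation in terms of p, and the error estimate *)

Lemma is_derive_comp2 (g gx gy : R -> R -> R) (v w : R -> R) s dv dw :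
  (forall x y, is_derive (fun z => g z y) x (gx x y)) ->
  (forall x y, is_derive (fun z => g x z) y (gy x y)) ->
  Ck2 0 gx -> Ck2 0 gy -> is_derive v s dv -> is_derive w s dw ->
  is_derive (fun t => g (v t) (w t)) s
    (gx (v s) (w s) * dv + gy (v s) (w s) * dw).
Proof.
intros Dx Dy Cx Cy Hv Hw. rewrite <- Rplus_0_r.
apply (is_derive_comp3 (fun x y _ => g x y) (fun x y _ => gx x y)
  (fun x y _ => gy x y)); auto.
- apply (Ck_continuous 0 _ Cx).
- apply (Ck_continuous 0 _ Cy).
- apply (is_derive_const (V := R_NormedModule)).
Qed.

(* Area preservation turns the two partial derivatives of
   p (G1 x y) y = G2 x y into the slope of p. *)
Lemma curve_slope G1 G2 G1x G1y G2x G2y p px py :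
  (forall x y, is_derive (fun z => G1 z y) x (G1x x y)) ->
  (forall x y, is_derive (fun z => G1 x z) y (G1y x y)) ->
  (forall x y, is_derive (fun z => G2 z y) x (G2x x y)) ->
  (forall x y, is_derive (fun z => G2 x z) y (G2y x y)) ->
  (forall x y, is_derive (fun z => p z y) x (px x y)) ->
  (forall x y, is_derive (fun z => p x z) y (py x y)) ->
  Ck2 0 px -> Ck2 0 py ->
  (forall x y, G1x x y * G2y x y - G1y x y * G2x x y = 1) ->
  (forall x y, p (G1 x y) y = G2 x y) ->
  forall x y, py (G1 x y) y * G1x x y = 1.
Proof.
intros D1x D1y D2x D2y Dpx Dpy Cpx Cpy HJ Hp x y.
assert (Ex : px (G1 x y) y * G1x x y + py (G1 x y) y * 0 = G2x x y).
{ rewrite <- (is_derive_unique _ _ _ (D2x x y)). symmetry. apply is_derive_unique.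
  apply (is_derive_ext (fun z => p (G1 z y) y)); [intros; apply Hp|].
  apply (is_derive_comp2 p px py (fun z => G1 z y) (fun _ => y)); auto.
  apply (is_derive_const (V := R_NormedModule)). }
assert (Ey : px (G1 x y) y * G1y x y + py (G1 x y) y * 1 = G2y x y).
{ rewrite <- (is_derive_unique _ _ _ (D2y x y)). symmetry. apply is_derive_unique.
  apply (is_derive_ext (fun z => p (G1 x z) z)); [intros; apply Hp|].
  apply (is_derive_comp2 p px py (fun z => G1 x z) (fun z => z)); auto.
  apply (is_derive_id (K := R_AbsRing)). }
specialize (HJ x y). rewrite <- Ex, <- Ey in HJ. lra.
Qed.

(** Cells are centred at grid points, so the first and last protrude from the domain by half a cell
    while their centres stay inside. For this reason the boxes constrain centres. *)
Lemma cell_center_in (lo hi h : R) (n : nat) (k : Z) : lo < hi -> (0 < n)%nat ->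
  h = (hi - lo) / INR n -> (0 <= k <= Z.of_nat n)%Z ->
  lo <= face lo h k + h / 2 <= hi.
Proof.
intros Hlh Hn Eh Hk.
assert (Hn' : 0 < INR n) by (apply lt_0_INR; exact Hn).
assert (Hh : 0 < h) by (rewrite Eh; apply Rdiv_lt_0_compat; lra).
assert (Enh : INR n * h = hi - lo) by (rewrite Eh; field; lra).
assert (0 <= IZR k <= INR n).
{ rewrite INR_IZR_INZ. split; apply IZR_le; lia. }
replace (face lo h k + h / 2) with (lo + IZR k * h) by (unfold face; field).
nra.
Qed.

Theorem proposition3p3
  (xmin xmax ymin ymax : R) (Hx : xmin < xmax) (Hy : ymin < ymax)
  (tn dt : R) (Hdt : 0 < dt)
  (a1 a2 : R -> R -> R -> R) (Ha1 : Ck 1 a1) (Ha2 : Ck 1 a2)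
  (Hdiv : divergence_free a1 a2 tn (tn + dt))
  (f : R -> R -> R -> R) (Hf : Ck 2 f)
  (Hfeq : solves_transport a1 a2 f tn (tn + dt))
  (X1 X2 : R -> R -> R -> R) (HX1 : Ck 3 X1) (HX2 : Ck 3 X2)
  (HX : is_characteristics a1 a2 X1 X2 tn (tn + dt))
  (invX invY : R -> R -> R)
  (HinvX : forall xi, mutual_inverse (fun x0 => X1 x0 xi tn) (invX xi))
  (HinvY : forall eta, mutual_inverse (fun y0 => X2 eta y0 tn) (invY eta))
  (Hp : Ck2 2 (curve_p X2 invX tn))
  (Hq : Ck2 2 (curve_q X1 invY tn))
  (d : nat) (Hd : (1 <= d)%nat)
  (ta : R) (Hta : tn <= ta <= tn + dt) :
  exists C h0 : R, 0 < h0 /\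
    forall (Nx Ny : nat) (h : R),
      (0 < Nx)%nat -> (0 < Ny)%nat ->
      h = (xmax - xmin) / INR Nx -> h = (ymax - ymin) / INR Ny ->
      h < h0 ->
      applicable xmin ymin h dt ta Nx Ny a1 a2 ->
      order_preserved xmin ymin h Nx Ny
        (fun x y => X1 x y tn) (fun x y => X2 x y tn) ->
      forall fbar : Z -> Z -> R,
        (forall k l : Z,
           fbar k l = cell_average xmin ymin h (fun x y => f x y tn) k l) ->
        forall k l : Z,
          (0 <= k <= Z.of_nat Nx)%Z -> (0 <= l <= Z.of_nat Ny)%Z ->
          Rabs (cell_average xmin ymin h (fun x y => f x y (tn + dt)) k l
                - ccsl_step d xmin ymin h (fun x y => X1 x y tn)
                    (curve_p X2 invX tn) fbar k l)
          <= C * h ^ 2.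
Proof.
assert (Ht : tn < tn + dt) by lra.
set (G1 := fun x y => X1 x y tn). set (G2 := fun x y => X2 x y tn).
set (p := curve_p X2 invX tn) in *.
assert (CG1 : Ck2 3 G1) by (apply Ck_slice; exact HX1).
assert (CG2 : Ck2 3 G2) by (apply Ck_slice; exact HX2).
(* The third derivative of the flow is spent here: G1x is of class C^2, as [slope_expansion]
   requires. *)
destruct (Ck2_derivatives _ _ CG1) as (G1x & G1y & D1x & D1y & C1x & C1y).
destruct (Ck2_derivatives _ _ CG2) as (G2x & G2y & D2x & D2y & C2x & C2y).
destruct (Ck2_derivatives _ _ Hp) as (px & py & Dpx & Dpy & Cpx & Cpy).
assert (HX1' : Ck 1 X1) by (do 2 apply Ck_pred; exact HX1).
assert (HX2' : Ck 1 X2) by (do 2 apply Ck_pred; exact HX2).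
assert (HJ : forall x y, G1x x y * G2y x y - G1y x y * G2x x y = 1).
{ intros x y. apply (characteristics_jacobian a1 a2 X1 X2 tn (tn + dt) x y); auto;
  [apply D1x|apply D1y|apply D2x|apply D2y]. }
assert (Hpinv : forall x y, p (G1 x y) y = G2 x y).
{ intros x y. unfold p, curve_p, G1, G2. now rewrite (proj1 (HinvX y)). }
assert (Hslope := curve_slope G1 G2 G1x G1y G2x G2y p px py D1x D1y D2x D2y Dpx Dpy
  (Ck2_pred _ _ Cpx) (Ck2_pred _ _ Cpy) HJ Hpinv).
assert (Hsize : forall Nx h, (0 < Nx)%nat -> h = (xmax - xmin) / INR Nx -> 0 < h).
{ intros Nx h HN ->. apply Rdiv_lt_0_compat; [lra|apply lt_0_INR; exact HN]. }
(* The slope identity excludes zeros of G1x. Its sign depends on the flow alone and is settled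
   before any mesh is chosen. *)
destruct (constant_sign G1x (Ck2_continuity_2d _ _ C1x)) as [Hpos|Hneg].
{ intros x y E. specialize (Hslope x y). rewrite E in Hslope. lra. }
(* A negative sign reverses the left-right order of backtracked corners, against [order_preserved];
   no mesh is left and the constants are arbitrary. *)
2:{ exists 0, 1. split; [lra|].
  intros Nx Ny h HNx HNy Eh _ _ _ [Hord _] fbar _ k l _ _. exfalso.
  specialize (Hsize Nx h HNx Eh).
  specialize (Hord 0%Z 0%Z ltac:(lia) ltac:(lia)). rewrite face_succ in Hord.
  destruct (mean_value (fun z => G1 z (face ymin h 0)) (fun z => G1x z (face ymin h 0))
    (face xmin h 0) (face xmin h 0 + h)) as [c [_ Ec]]; [auto|].
  specialize (Hneg c (face ymin h 0)). unfold G1 in *. nra. }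
assert (CG : cascade_geometry G1 G1x G1y p px py (fun x y => invX y x)).
{ constructor; auto.
  - apply Ck2_pred. exact CG1.
  - intros x y. apply (proj2 (HinvX y)).
  (* [Hslope] speaks of points (G1 x y, y); the right inverse shows that every point has this
     form. *)
  - intros x y. rewrite <- (Hslope (invX y x) y). f_equal. f_equal.
    symmetry. apply (proj2 (HinvX y)). }
(* A crude radius containing the cell centres of every mesh. *)
set (R0 := Rabs xmin + Rabs xmax + Rabs ymin + Rabs ymax).
destruct (cascade_mass d (fun x y => f x y tn) _ _ _ _ _ _ _ R0 Hd
  (Ck_slice 2 f tn Hf) CG) as (C & h0 & HC & Hh0 & Hmass).
destruct (cell_average_center (fun x y => f x y (tn + dt)) R0
  (Ck_slice 2 f (tn + dt) Hf)) as (M & HM & Havg).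
exists (M + C), h0. split; [lra|].
intros Nx Ny h HNx HNy Ehx Ehy Hh _ _ fbar Hfbar k l Hk Hl.
assert (Hh' := Hsize Nx h HNx Ehx).
assert (Bx := cell_center_in xmin xmax h Nx k Hx HNx Ehx Hk).
assert (By := cell_center_in ymin ymax h Ny l Hy HNy Ehy Hl).
set (x0 := face xmin h k + h / 2) in *. set (y0 := face ymin h l + h / 2) in *.
assert (Hx0 : Rabs x0 <= R0).
{ unfold R0. apply Rabs_le. revert Bx.
  unfold Rabs. repeat destruct Rcase_abs; lra. }
assert (Hy0 : Rabs y0 <= R0).
{ unfold R0. apply Rabs_le. revert By.
  unfold Rabs. repeat destruct Rcase_abs; lra. }
assert (A1 := Havg xmin ymin h k l ltac:(lra) Hx0 Hy0).
assert (A2 := Hmass xmin ymin h k l ltac:(lra) Hx0 Hy0 fbar Hfbar).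
fold x0 y0 in A1, A2. cbv beta zeta in A2.
rewrite Hpinv in A2.
assert (Etr : f x0 y0 (tn + dt) = f (G1 x0 y0) (G2 x0 y0) tn).
{ apply (transport_along_characteristics a1 a2 f X1 X2); auto; apply Ck_pred; auto. }
rewrite Etr in A1. unfold ccsl_step.
set (v := f (G1 x0 y0) (G2 x0 y0) tn) in *.
(* Average and mass are both compared with the value v at the foot; division by h^2 turns the mass
   error O(h^4) into O(h^2). *)
match goal with |- Rabs (?s - ?m / (h * h)) <= _ => replace (s - m / (h * h)) with
  ((s - v) - (m - h ^ 2 * v) * / h ^ 2) by (field; lra) end.
rewrite Rmult_plus_distr_r. apply Rabs_minus_le; [exact A1|].
replace (C * h ^ 2) with (C * h ^ 4 * / h ^ 2) by (field; lra).
apply Rabs_mult_le; [exact A2|].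
rewrite Rabs_pos_eq; [lra|]. left. apply Rinv_0_lt_compat. apply pow_lt. lra.
Qed.
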